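(* Let $\mathbb{K}$ be a field of characteristic zero. Chudnovsky's Conjecture holds for any number of generic points in $\mathbb{P}^3$; that is, if $n\ge 1$ and $I=\bigcap_{j=1}^{n}\mathfrak{m}_{p_j}\subset \mathbb{K}[\mathbb{P}^3]$ is the ideal of $n$ points $p_1,\dots,p_n$ in general position in $\mathbb{P}^3$, then for all $m\ge 1$ $$\alpha(I^{(m)})\ \ge\ m\,\frac{\alpha(I)+2}{3}.$$
   Context: $\mathbb{K}[\mathbb{P}^3]=\mathbb{K}[x_0,x_1,x_2,x_3]$ is the coordinate ring of $\mathbb{P}^3$ with the standard grading. For a point $p\in\mathbb{P}^3$, $\mathfrak{m}_p$ is the ideal of forms vanishing at $p$. The $m$-th symbolic power of $I=\bigcap_{j=1}^n\mathfrak{m}_{p_j}$ is $I^{(m)}=\bigcap_{j=1}^n\mathfrak{m}_{p_j}^{m}$. For a nonzero homogeneous ideal $J$, $\alpha(J)$ is the least degree $t\ge 0$ of a nonzero form in $J$. Chudnovsky's Conjecture states that for the ideal $I$ of a finite set of points in $\mathbb{P}^N$ one has $\alpha(I^{(m)})\ge m\frac{\alpha(I)+N-1}{N}$. One ideal $I$ of points in general position is fixed, and the inequality is asserted for this $I$ for every $m\ge 1$. *)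

(* Defs.v *)
From HB Require Import structures.
From Stdlib Require Import ClassicalEpsilon.
From mathcomp Require Import all_boot all_order all_algebra.
From mathcomp Require Import mpoly.

Set Implicit Arguments.
Unset Strict Implicit.
Unset Printing Implicit Defensive.

Import GRing.Theory.
Local Open Scope ring_scope.

Definition ideal_span (R : comNzRingType) (G : R -> Prop) (f : R) : Prop :=
  exists (r : nat) (c g : 'I_r -> R),
    (forall k, G (g k)) /\ f = \sum_(k < r) c k * g k.

Definition ideal_pow (R : comNzRingType) (J : R -> Prop) (m : nat) : R -> Prop :=
  ideal_span (fun f => exists g : 'I_m -> R,
    (forall i, J (g i)) /\ f = \prod_(i < m) g i).

(* A point of P^N is given by a nonzero vector of homogeneous coordinates.
   Rescaling the vector gives the same point: point_ideal and the sets
   satisfying zariski_open do not change under rescaling. *)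
Definition point (K : fieldType) (N : nat) : Type :=
  {v : 'rV[K]_N.+1 | v != 0}.

Definition coord (K : fieldType) (N : nat) (p : point K N) (i : 'I_N.+1) : K :=
  val p 0 i.

Definition point_ideal (K : fieldType) (N : nat) (p : point K N) :
    {mpoly K[N.+1]} -> Prop :=
  ideal_span (fun f => (exists d : nat, f \is d.-homog) /\ f.@[coord p] = 0).

Definition points_ideal (K : fieldType) (N n : nat) (p : 'I_n -> point K N) :
    {mpoly K[N.+1]} -> Prop :=
  fun f => forall j, point_ideal (p j) f.

Definition symbolic_power (K : fieldType) (N n : nat) (p : 'I_n -> point K N)
    (m : nat) : {mpoly K[N.+1]} -> Prop :=
  fun f => forall j, ideal_pow (point_ideal (p j)) m f.

Definition has_form (K : fieldType) (k : nat) (J : {mpoly K[k]} -> Prop)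
    (t : nat) : Prop :=
  exists f : {mpoly K[k]}, [/\ J f, f != 0 & f \is t.-homog].

(* Unspecified when J contains no nonzero form. *)
Definition alpha (K : fieldType) (k : nat) (J : {mpoly K[k]} -> Prop) : nat :=
  epsilon (inhabits 0%N)
    (fun t => has_form J t /\ forall s, has_form J s -> (t <= s)%N).

(* Polynomials on (P^N)^n have n * (N + 1) variables; the variable of index
   mxvec_index j i is the i-th homogeneous coordinate of the j-th point. *)
Definition multihomog (K : fieldType) (N n : nat)
    (F : {mpoly K[n * N.+1]}) : Prop :=
  exists d : 'I_n -> nat, forall mon : 'X_{1..(n * N.+1)}, mon \in msupp F ->
    forall j : 'I_n, (\sum_(i < N.+1) mon (mxvec_index j i))%N = d j.

Definition eval_points (K : fieldType) (N n : nat) (p : 'I_n -> point K N)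
    (F : {mpoly K[n * N.+1]}) : K :=
  F.@[fun k => mxvec (\matrix_(j < n, i < N.+1) coord (p j) i) 0 k].

Definition zariski_open (K : fieldType) (N n : nat)
    (U : ('I_n -> point K N) -> Prop) : Prop :=
  exists S : {mpoly K[n * N.+1]} -> Prop,
    (forall F, S F -> multihomog F) /\
    (forall p, U p <-> exists2 F, S F & eval_points p F != 0).

(* P holds for n points in general position: it holds on a nonempty
   Zariski-open subset of (P^N)^n. *)
Definition general_position (K : fieldType) (N n : nat)
    (P : ('I_n -> point K N) -> Prop) : Prop :=
  exists U : ('I_n -> point K N) -> Prop,
    [/\ zariski_open U, exists p, U p & forall p, U p -> P p].

(* Main.v *)
From HB Require Import structures.
Require Import Defs.
From Stdlib Require Import Classical ClassicalEpsilon FunctionalExtensionality.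
From mathcomp Require Import all_boot all_order all_algebra perm closed_field.
From mathcomp Require Import mpoly.
From mathcomp Require Import zify ring.

Set Implicit Arguments.
Unset Strict Implicit.
Unset Printing Implicit Defensive.

Import Order.TTheory GRing.Theory Num.Theory.
Local Open Scope ring_scope.

(* Let a be the initial degree for n general points: binom(a+2,3) <= n and
   n < binom(a+3,3). As alpha(I) <= a, it is enough to show 3d >= m(a+2) for
   every nonzero form F of degree d with multiplicity m at the points.

   For a = 1 this is d >= m, and for a = 2 four of the points can be taken as the
   coordinate points, at which the multiplicity bounds every exponent by d - m.

   For a >= 3 the open set has to be the same for all m. There are k and D with
   3D >= (k+4)(a+2) and a special configuration of n points (a cubic grid, or a
   grid-like set of 18 points when a = 4) at which no form of degree D has
   multiplicity k; a maximal minor of the interpolation matrix is then nonzero,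
   and its nonvanishing is the open condition. Given a form F violating the
   bound at points where the minor does not vanish, reduce everything to a field
   of characteristic p, keeping the minor nonzero. With q a large power of p,
   some power of F has multiplicity at least q(k+4). Since K[x] is free over
   K[x^q], a form of multiplicity q(k+4) at b has a component G(x^q) with G of
   multiplicity k at b^q. The degree of G is at most D, which contradicts the
   nonvanishing of the minor at b^q. *)

(** * Specialization to positive characteristic *)

Lemma ex_minimal (Q : nat -> Prop) :
  (exists n, Q n) -> exists2 n, Q n & forall m, Q m -> (n <= m)%N.
Proof.
case=> n; elim/ltn_ind: n => n IHn Qn.
have [[m [lt_mn Qm]]|noQ] := classic (exists m, (m < n)%N /\ Q m).
  exact: IHn lt_mn Qm.
exists n => // m Qm; rewrite leqNgt; apply/negP=> lt_mn.
by apply: noQ; exists m.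
Qed.

(* The kernel condition says that [psi] factors through the subring [phi A] of [K]. *)
Definition specializable (K : fieldType) (A : idomainType)
    (phi : {rmorphism A -> K}) : Prop :=
  forall g, phi g != 0 ->
  exists (p : nat) (L : closedFieldType) (psi : {rmorphism A -> L}),
    [/\ p \in [pchar L], psi g != 0 & forall x, phi x = 0 -> psi x = 0].

Lemma intr_eq0_absz (R : nzRingType) (z : int) :
  (z%:~R == 0 :> R) = (`|z|%N%:R == 0 :> R).
Proof. by case: z => m //; rewrite NegzE rmorphN oppr_eq0. Qed.

(** A prime larger than [|g|] does not divide [g], and in characteristic zero the map to [K] has
    zero kernel. *)
Lemma specializable_int (K : fieldType) (charK0 : [pchar K] =i pred0) :
  specializable (intmul 1 : {rmorphism int -> K}).
Proof.
move=> g g_neq0.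
have g_gt0 : (0 < `|g|)%N.
  by rewrite lt0n absz_eq0; apply: contraNneq g_neq0 => ->; rewrite /= mulr0z.
have [p p_gt p_pr] := prime_above `|g|.
have [L [iota _]] := countable_algebraic_closure 'F_p.
have charL : p \in [pchar L] by rewrite (fmorph_pchar iota) pchar_Fp.
exists p, L, (intmul 1 : {rmorphism int -> L}); split=> //=.
  rewrite intr_eq0_absz -(dvdn_pcharf charL).
  by apply/negP=> /(dvdn_leq g_gt0); rewrite leqNgt p_gt.
move=> x /eqP; rewrite intr_eq0_absz.
by have /pcharf0P -> := charK0; rewrite absz_eq0 => /eqP ->.
Qed.

Section Extension.

Variables (K : fieldType) (A : idomainType) (phi : {rmorphism A -> K}).
Hypothesis phi_spec : specializable phi.
Variable x : K.

Let ev : {rmorphism {poly A} -> K} := horner_eval x \o map_poly phi.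

Let evE P : ev P = (map_poly phi P).[x]. Proof. by []. Qed.

(** [phi] may kill leading coefficients. Truncation at the size of the image gives a representative
    whose leading coefficient survives, as pseudo-division requires. *)
Lemma map_poly_trim (P : {poly A}) :
  exists2 Q, map_poly phi Q = map_poly phi P & size Q = size (map_poly phi Q).
Proof.
pose n := size (map_poly phi P).
have eqQ : map_poly phi (\poly_(i < n) P`_i) = map_poly phi P.
  apply/polyP=> i; rewrite !coef_map coef_poly.
  case: ltnP => // le_ni; rewrite -[in RHS]coef_map nth_default //.
  exact: rmorph0.
exists (\poly_(i < n) P`_i); first exact: eqQ.
rewrite eqQ.
apply/eqP; rewrite -/n eqn_leq size_poly /=.
case Dn : n => [|m] //; rewrite ltnNge; apply/negP=> /leq_sizeP/(_ m (leqnn _)).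
rewrite coef_poly ltnSn => Pm0.
have : lead_coef (map_poly phi P) = 0.
  rewrite lead_coefE -/n Dn /= coef_map Pm0; exact: rmorph0.
by move/eqP; rewrite lead_coef_eq0 -size_poly_eq0 -/n Dn.
Qed.

(** As [x] satisfies no relation, it may be sent to any [y] in [L]: keep one coefficient of [g]
    nonzero and take [y] off the roots of the image of [g]. *)
Lemma specializable_transcendental :
  (forall P, ev P = 0 -> map_poly phi P = 0) -> specializable ev.
Proof.
move=> trx g g_neq0.
have : map_poly phi g != 0.
  by apply: contraNneq g_neq0; rewrite evE => ->; rewrite horner0.
rewrite -lead_coef_eq0 lead_coefE coef_map; set i := _.-1.
case/phi_spec=> p [L [psi [charL psig ker]]].
have psig_neq0 : map_poly psi g != 0.
  apply: contraNneq psig => /(congr1 (fun P : {poly L} => P`_i)).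
  by rewrite coef_map coef0 => ->.
have [y gy] := closed_nonrootP _ psig_neq0.
exists p, L, (horner_eval y \o map_poly psi : {rmorphism {poly A} -> L}).
split=> // P /trx P0 /=.
suff -> : map_poly psi P = 0 by rewrite /horner_eval horner0.
apply/polyP=> j; rewrite coef_map coef0; apply: ker.
by rewrite -coef_map P0 coef0.
Qed.

Lemma lead_coef_trimmed (Q : {poly A}) :
  map_poly phi Q != 0 -> size Q = size (map_poly phi Q) ->
  phi (lead_coef Q) != 0.
Proof.
by move=> Q_neq0 sz; rewrite lead_coefE sz -coef_map -lead_coefE lead_coef_eq0.
Qed.

(** Let [P] be a relation of least degree for [x]. Some multiple of [g] has a nonzero value [phi r].
    A specialization that keeps [r] and the leading coefficient of [P] nonzero extends by sending
    [x] to a root of the image of [P]. *)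
Lemma specializable_algebraic :
  (exists P, ev P = 0 /\ map_poly phi P != 0) -> specializable ev.
Proof.
move=> algx.
have : exists n P, [/\ ev P = 0, map_poly phi P != 0 & size (map_poly phi P) = n].
  by have [P [? ?]] := algx; exists (size (map_poly phi P)), P.
case/ex_minimal=> n [P0 [ev0 P0_neq0 szP0]] minP0.
have [P eqP0 szP] := map_poly_trim P0.
have evP : ev P = 0 by rewrite evE eqP0.
have P_neq0 : map_poly phi P != 0 by rewrite eqP0.
have szPn : size P = n by rewrite szP eqP0.
have minP Q : ev Q = 0 -> (size Q < n)%N -> map_poly phi Q = 0.
  move=> evQ ltQn; apply: contraTeq ltQn => Q_neq0; rewrite -leqNgt.
  apply: leq_trans (size_poly _ _).
  by apply: minP0; exists Q.
have Pn0 : P != 0 by apply: contraNneq P_neq0 => ->; rewrite rmorph0.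
have lcP := lead_coef_trimmed P_neq0 szP.
have evC c : ev c%:P = phi c by rewrite evE map_polyC hornerC.
have evZ c Q : ev (c *: Q) = phi c * ev Q by rewrite -mul_polyC rmorphM evC.
(* Inversion with cleared denominators: among the multiples of [g] with nonzero value, one of least
   size is constant, as division of [P] by it shows. *)
have inverse g : ev g != 0 -> exists w r, phi r != 0 /\ ev w * ev g = phi r.
  move=> g_neq0.
  have : exists m Q, [/\ ev Q != 0, exists w, ev Q = ev w * ev g
                      & size (map_poly phi Q) = m].
    exists (size (map_poly phi g)), g; split=> //.
    by exists 1; rewrite rmorph1 mul1r.
  case/ex_minimal=> m [Q0 [evQ0 [w evQw] szQ0]] minQ0.
  have [Q eqQ0 szQ] := map_poly_trim Q0.
  have {}evQ0 : ev Q != 0 by rewrite evE eqQ0.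
  have {}evQw : ev Q = ev w * ev g by rewrite evE eqQ0.
  have szQm : size Q = m by rewrite szQ eqQ0.
  have minQ R v : ev R = ev v * ev g -> (size R < m)%N -> ev R = 0.
    move=> evR ltRm; apply: contraTeq ltRm => R_neq0; rewrite -leqNgt.
    apply: leq_trans (size_poly _ _).
    by apply: minQ0; exists R; split=> //; exists v.
  have Q_neq0 : map_poly phi Q != 0.
    by apply: contraNneq evQ0; rewrite evE => ->; rewrite horner0.
  have Qn0 : Q != 0 by apply: contraNneq Q_neq0 => ->; rewrite rmorph0.
  have lcQ := lead_coef_trimmed Q_neq0 szQ.
  (* Otherwise the pseudo-remainder modulo [P] is a smaller multiple of [g]; its value is that of
     [Q] times a power of the leading coefficient of [P], hence nonzero. *)
  have ltQn : (size Q < n)%N.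
    have /(congr1 ev) := Pdiv.Idomain.divp_eq Q P.
    rewrite evZ rmorphD rmorphM evP mulr0 add0r.
    move: (X in _ ^+ X) => k evR.
    rewrite ltnNge -szPn; apply/negP=> lePQ.
    have ltR : (size (Q %% P)%R < m)%N.
      by rewrite -szQm; apply: leq_trans lePQ; rewrite Pdiv.Idomain.ltn_modp.
    have evRw : ev (Q %% P) =
        ev ((lead_coef P ^+ k)%:P * w) * ev g.
      by rewrite -evR evQw rmorphM evC mulrA.
    have /eqP := minQ _ _ evRw ltR.
    by rewrite -evR rmorphXn mulf_eq0 expf_eq0 (negPf lcP) andbF (negPf evQ0).
  have szQ1 : (size Q <= 1)%N.
    rewrite leqNgt; apply/negP=> ltQ.
    have eqD := Pdiv.Idomain.divp_eq P Q.
    have /(congr1 ev) := eqD.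
    rewrite evZ evP mulr0 rmorphD rmorphM => /esym/eqP.
    rewrite addrC addr_eq0 => /eqP evR.
    have ltR : (size (P %% Q)%R < m)%N by rewrite -szQm Pdiv.Idomain.ltn_modp.
    have evR0 : ev (P %% Q) = 0.
      apply: (minQ _ (- (P %/ Q) * w)) ltR.
      by rewrite evR evQw rmorphM rmorphN !mulNr mulrA.
    (* Minimality of [P] kills the remainder, then the quotient, and so a nonzero multiple of
       [P]. *)
    have R0 : map_poly phi (P %% Q) = 0.
      apply: minP; first exact: evR0.
      by apply: leq_trans ltR _; rewrite -szQm ltnW.
    have S0 : map_poly phi (P %/ Q) = 0.
      apply: minP.
        by move/eqP: evR; rewrite evR0 eq_sym oppr_eq0 mulf_eq0 (negPf evQ0) orbF => /eqP.
      rewrite Pdiv.Idomain.size_divp // szPn.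
      by rewrite ltn_subrL -subn1 subn_gt0 ltQ -szPn size_poly_gt0.
    have /eqP : map_poly phi (P %/ Q * Q + P %% Q) = 0.
      by rewrite rmorphD /= R0 addr0 rmorphM /= S0 mul0r.
    rewrite -eqD map_polyZ scaler_eq0 (negPf P_neq0) orbF.
    by rewrite rmorphXn expf_eq0 (negPf lcQ) andbF.
  have Dq := size1_polyC szQ1.
  exists w, Q`_0; split; last by rewrite -evQw {1}Dq evC.
  by rewrite -evC -Dq.
move=> g /inverse[w [r [r_neq0 wg]]].
have : phi (lead_coef P * r) != 0 by rewrite rmorphM mulf_neq0.
case/phi_spec=> p [L [psi [charL]]].
rewrite rmorphM mulf_eq0 negb_or => /andP[psil psir] ker.
have szPpsi : size (map_poly psi P) = n by rewrite size_map_poly_id0.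
(* Were [P] constant, its leading coefficient would map to the value of [P] at [x], which is
   zero. *)
have : size (map_poly psi P) != 1.
  rewrite szPpsi -szPn; apply/eqP=> sz1.
  have Dp : P = (P`_0)%:P by apply: size1_polyC; rewrite sz1.
  have : phi P`_0 = 0 by rewrite -evC -Dp.
  by move=> P00; case/eqP: lcP; rewrite lead_coefE sz1.
case/closed_rootP=> y /rootP Py0.
pose ev' : {rmorphism {poly A} -> L} := horner_eval y \o map_poly psi.
(* The remainder of [H] modulo [P] is a relation of smaller size, so its coefficients lie in the
   kernel of [phi], hence in that of [psi]. *)
have ker' H : ev H = 0 -> ev' H = 0.
  move=> evH; have eqD := Pdiv.Idomain.divp_eq H P.
  have evR : ev (H %% P) = 0.
    by have /(congr1 ev) := eqD; rewrite evZ evH rmorphD rmorphM evP !mulr0 add0r.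
  have R0 : map_poly psi (H %% P) = 0.
    have /minP : ev (H %% P) = 0 by [].
    rewrite -szPn Pdiv.Idomain.ltn_modp => /(_ Pn0) R0.
    apply/polyP=> j; rewrite coef_map coef0; apply: ker.
    by rewrite -coef_map R0 coef0.
  have /eqP := congr1 ev' eqD.
  rewrite rmorphD rmorphM /= /horner_eval Py0 mulr0 add0r R0 horner0.
  by rewrite map_polyZ hornerZ mulf_eq0 rmorphXn expf_eq0 (negPf psil) andbF => /eqP.
exists p, L, ev'; split=> //.
have : ev (w * g - r%:P) = 0 by rewrite rmorphB rmorphM wg evC subrr.
move/ker'; rewrite rmorphB rmorphM => /eqP; rewrite subr_eq0 => /eqP wg'.
apply: contraNneq psir => g0; move: wg'; rewrite g0 mulr0.
by rewrite /= /horner_eval map_polyC hornerC => <-.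
Qed.

Lemma specializable_adjoin : specializable ev.
Proof.
have [alg|tr] := classic (exists P, ev P = 0 /\ map_poly phi P != 0).
  exact: specializable_algebraic.
apply: specializable_transcendental => P evP.
by apply/eqP/negPn/negP=> P_neq0; apply: tr; exists P.
Qed.

End Extension.

(** [A] is an iterated polynomial ring over the integers, with one variable for each element of
    [s]. *)
Lemma specializable_subring (K : fieldType) (charK0 : [pchar K] =i pred0)
    (s : seq K) :
  exists (A : idomainType) (phi : {rmorphism A -> K}),
    specializable phi /\ forall x, x \in s -> exists a, phi a = x.
Proof.
elim: s => [|x s [A [phi [phi_spec phiP]]]].
  by exists int, (intmul 1 : {rmorphism int -> K}); split=> //; exact: specializable_int.
exists {poly A}, (horner_eval x \o map_poly phi : {rmorphism {poly A} -> K}).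
split=> [|y]; first exact: specializable_adjoin.
rewrite inE => /orP[/eqP->|/phiP[a <-]] /=.
  by exists 'X; rewrite /horner_eval map_polyX hornerX.
by exists a%:P; rewrite /horner_eval map_polyC hornerC.
Qed.

(** * Multiplicity at a point and Frobenius components *)

Section Multiplicity.

Variables (R : comNzRingType) (N : nat).
Implicit Types (a : 'I_N -> R) (F G : {mpoly R[N]}) (m : nat).

Definition shift a F : {mpoly R[N]} := F \mPo [tuple 'X_i + (a i)%:MP | i < N].

HB.instance Definition _ a := GRing.RMorphism.copy (shift a) (shift a).
HB.instance Definition _ a := GRing.Linear.copy (shift a) (shift a).

(** Taylor coefficients are used instead of derivatives, so that the notion is the right one in
    characteristic [p] as well. *)
Definition mult_ge m a F := forall b, (mdeg b < m)%N -> (shift a F)@_b = 0.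

Lemma shiftX a i : shift a 'X_i = 'X_i + (a i)%:MP.
Proof. by rewrite /shift comp_mpolyXU -tnth_nth tnth_mktuple. Qed.

Lemma shiftC a c : shift a c%:MP = c%:MP.
Proof. exact: comp_mpolyC. Qed.

Lemma shiftE a F : shift a F = \sum_(b <- msupp F) F@_b *: shift a 'X_[b].
Proof. exact: comp_mpolyEX. Qed.

Lemma shiftK a F : shift (fun i => - a i) (shift a F) = F.
Proof.
rewrite (shiftE a) [RHS]mpolyE linear_sum; apply: eq_bigr => b _ /=.
rewrite linearZ /= [in LHS]mpolyXE_id [in RHS]mpolyXE_id !rmorph_prod.
congr (_ *: _); apply: eq_bigr => i _.
by rewrite !rmorphXn /= shiftX rmorphD /= shiftX shiftC mpolyCN subrK.
Qed.

Lemma taylor a F :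
  F = \sum_(b <- msupp (shift a F))
        (shift a F)@_b *: \prod_(i < N) ('X_i - (a i)%:MP) ^+ b i.
Proof.
rewrite -{1}(shiftK a F) {1}/shift comp_mpolyE; apply: eq_bigr => b _.
by congr (_ *: _); apply: eq_bigr => i _; rewrite tnth_mktuple mpolyCN.
Qed.

Lemma shift_monomial a (b : 'X_{1..N}) :
  shift a (\prod_(i < N) ('X_i - (a i)%:MP) ^+ b i) = 'X_[b].
Proof.
rewrite rmorph_prod mpolyXE_id; apply: eq_bigr => i _.
by rewrite rmorphXn rmorphB /= shiftX shiftC addrK.
Qed.

Lemma mult_geP m a F :
  mult_ge m a F <-> forall b, b \in msupp (shift a F) -> (m <= mdeg b)%N.
Proof.
split=> H b; last first.
  by move=> ltbm; apply: memN_msupp_eq0; apply/negP=> /H; rewrite leqNgt ltbm.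
rewrite mcoeff_msupp => nz; rewrite leqNgt; apply/negP=> /H nz0.
by rewrite nz0 eqxx in nz.
Qed.

Lemma mult_ge_zero m a : mult_ge m a 0.
Proof. by move=> b _; rewrite rmorph0 mcoeff0. Qed.

Lemma mult_geD m a F G : mult_ge m a F -> mult_ge m a G -> mult_ge m a (F + G).
Proof. by move=> hF hG b ltb; rewrite rmorphD mcoeffD hF ?hG ?addr0. Qed.

Lemma mult_geZ m a c F : mult_ge m a F -> mult_ge m a (c *: F).
Proof. by move=> hF b ltb; rewrite linearZ /= mcoeffZ hF ?mulr0. Qed.

Lemma mult_geM m k a F G :
  mult_ge m a F -> mult_ge k a G -> mult_ge (m + k) a (F * G).
Proof.
move=> /mult_geP hF /mult_geP hG; apply/mult_geP=> b.
rewrite rmorphM => /msuppM_le /allpairsP[[b1 b2] [/= /hF le1 /hG le2 ->]].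
by rewrite mdegD leq_add.
Qed.

Lemma mult_geW m k a F : (k <= m)%N -> mult_ge m a F -> mult_ge k a F.
Proof. by move=> lekm hF b ltb; apply: hF; apply: leq_trans lekm. Qed.

Lemma mult_geMl m a F G : mult_ge m a G -> mult_ge m a (F * G).
Proof. by move=> hG; rewrite -[m]add0n; apply: mult_geM. Qed.

Lemma mult_ge_sum m a (I : Type) (r : seq I) (P : pred I) (F : I -> {mpoly R[N]}) :
  (forall i, P i -> mult_ge m a (F i)) -> mult_ge m a (\sum_(i <- r | P i) F i).
Proof.
by move=> H; apply: big_ind => // [|? ? ? ?]; [apply: mult_ge_zero | apply: mult_geD].
Qed.

Lemma mult_ge_prod a (I : Type) (r : seq I) (f : I -> nat) (F : I -> {mpoly R[N]}) :
  (forall i, mult_ge (f i) a (F i)) ->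
  mult_ge (\sum_(i <- r) f i) a (\prod_(i <- r) F i).
Proof. by move=> H; elim/big_rec2: _ => // i x y _ IH; apply: mult_geM. Qed.

Lemma mult_geX m k a F : mult_ge m a F -> mult_ge (k * m) a (F ^+ k).
Proof. by move=> hF; elim: k => // k IHk; rewrite exprS mulSn; apply: mult_geM. Qed.

End Multiplicity.

Lemma map_shift (R S : comNzRingType) N (f : {rmorphism R -> S}) (a : 'I_N -> R)
    (F : {mpoly R[N]}) :
  map_mpoly f (shift a F) = shift (f \o a) (map_mpoly f F).
Proof.
have -> : map_mpoly f F = \sum_(b <- msupp F) f F@_b *: 'X_[b].
  rewrite {1}[F]mpolyE raddf_sum; apply: eq_bigr => b _.
  by rewrite [LHS]map_mpolyZ map_mpolyX.
rewrite shiftE raddf_sum (linear_sum (shift _)); apply: eq_bigr => b _.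
rewrite [LHS]map_mpolyZ linearZ; congr (_ *: _).
rewrite mpolyXE_id [in RHS]mpolyXE_id !rmorph_prod; apply: eq_bigr => i _ /=.
by rewrite !rmorphXn /= !shiftX rmorphD /= map_mpolyX map_mpolyC.
Qed.

Section FrobeniusComponents.

Variables (R : comNzRingType) (N q : nat).
Hypothesis q_gt0 : (0 < q)%N.
Implicit Types (F G : {mpoly R[N]}) (r v w : 'X_{1..N}).

(** For [r] with exponents below [q], this is the coordinate of [F] at [x^r] in the monomial basis
    over the ring of polynomials in [x^q], rewritten with [x] in place of [x^q]. *)
Definition frob_comp r F : {mpoly R[N]} :=
  \sum_(v : 'X_{1..N < msize F}) F@_(r + v *+ q)%MM *: 'X_[v].

Lemma mcoeff_frob_comp r F v : (frob_comp r F)@_v = F@_(r + v *+ q)%MM.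
Proof.
have [ltv|lev] := ltnP (mdeg v) (msize F).
  by rewrite /frob_comp (mcoeff_mpoly (fun v => F@_(r + v *+ q)%MM)).
rewrite /frob_comp raddf_sum big1 /= => [|w _].
  apply/esym/memN_msupp_eq0/msize_mdeg_ge/(leq_trans lev).
  rewrite mdegD mdegMn; nia.
rewrite mcoeffZ mcoeffX; case: eqP => [eqwv|]; last by rewrite mulr0.
by have := bmdeg w; rewrite eqwv ltnNge lev.
Qed.

Lemma frob_comp_linear r : linear (frob_comp r).
Proof.
move=> c F G; apply/mpolyP=> v.
by rewrite mcoeffD mcoeffZ !mcoeff_frob_comp mcoeffD mcoeffZ.
Qed.

HB.instance Definition _ r :=
  GRing.isLinear.Build R {mpoly R[N]} {mpoly R[N]} _ (frob_comp r)
    (frob_comp_linear r).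

Lemma mcoeffMX_eq0 F v w : ~~ (v <= w)%MM -> (F * 'X_[v])@_w = 0.
Proof.
move=> nle; apply: memN_msupp_eq0; rewrite (perm_mem (msuppMX _ _)).
by apply: contra nle => /mapP[w' _ ->]; rewrite lem_addr.
Qed.

(** A coordinate is linear over polynomials in [x^q]. As the exponents of [r] are below [q], the
    monomial of exponent [r + q w] is divisible by [x^(q v)] only if [v <= w]. *)
Lemma frob_compM r F G : (forall i, r i < q)%N ->
  frob_comp r (F * (G \mPo [tuple 'X_i ^+ q | i < N])) = frob_comp r F * G.
Proof.
move=> ltrq; rewrite [G]mpolyE raddf_sum !mulr_sumr raddf_sum /=.
apply: eq_bigr => v _; rewrite comp_mpolyZ -!scalerAr linearZ /=; congr (_ *: _).
have -> : 'X_[v] \mPo [tuple 'X_i ^+ q | i < N] = 'X_[R, v *+ q].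
  rewrite comp_mpolyX mpolyXE_id; apply: eq_bigr => i _.
  by rewrite tnth_mktuple -exprM mulmnE mulnC.
apply/mpolyP=> w; rewrite mcoeff_frob_comp.
have [lev|nlev] := boolP (v <= w)%MM.
  rewrite -(submK lev) [(w - v + v)%MM]addmC mcoeffMX mcoeff_frob_comp.
  rewrite -(mcoeffMX F (v *+ q)); congr (mcoeff _ _).
  by apply/mnmP=> i; rewrite !(mnmDE, mulmnE); nia.
rewrite !mcoeffMX_eq0 //; apply: contra nlev => /mnm_lepP le.
apply/mnm_lepP=> i; have := le i; have := ltrq i.
rewrite mnmDE !mulmnE; nia.
Qed.

End FrobeniusComponents.

(** Write a Taylor exponent as [b = u + q v] with [u < q]. By Frobenius [(x - a)^b] is [(x - a)^u]
    times [(y - a^q)^v] at [y = x^q], and the last factor comes out of the component. As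
    [|b| <= q |v| + q N], its order [|v|] is at least [m]. *)
Lemma mult_ge_frob (p e : nat) (L : fieldType) (charL : p \in [pchar L]) (N m : nat)
    (a : 'I_N -> L) (F : {mpoly L[N]}) (r : 'X_{1..N}) (q := (p ^ e)%N) :
  (forall i, r i < q)%N -> mult_ge (q * (m + N)) a F ->
  mult_ge m (fun i => a i ^+ q) (frob_comp q r F).
Proof.
move=> ltrq /mult_geP hF; have p_pr := pcharf_prime charL.
have q_gt0 : (0 < q)%N by rewrite expn_gt0 prime_gt0.
rewrite [F](taylor a) linear_sum big_seq; apply: mult_ge_sum => b /hF leb.
rewrite linearZ /=; apply: mult_geZ.
pose u := [multinom (b i %% q)%N | i < N]; pose v := [multinom (b i %/ q)%N | i < N].
have -> : \prod_(i < N) ('X_i - (a i)%:MP) ^+ b i =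
    (\prod_(i < N) ('X_i - (a i)%:MP) ^+ u i) *
    ((\prod_(i < N) ('X_i - (a i ^+ q)%:MP) ^+ v i) \mPo [tuple 'X_i ^+ q | i < N])
    :> {mpoly L[N]}.
  rewrite rmorph_prod -big_split; apply: eq_bigr => i _ /=.
  rewrite rmorphXn rmorphB /= comp_mpolyC comp_mpolyXU -tnth_nth tnth_mktuple.
  have charN : [pchar {mpoly L[N]}].-nat q.
    rewrite /q pnatX; apply/orP; left; rewrite pnatE //.
    by rewrite inE p_pr /= -mpolyC_nat (pcharf0 charL) mpolyC0.
  have -> : (a i ^+ q)%:MP_[N] = (a i)%:MP ^+ q by rewrite rmorphXn.
  rewrite -exprNn_pchar // -exprDn_pchar // -exprM -exprD !mnmE.
  by rewrite mulnC addnC -divn_eq.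
rewrite frob_compM //; apply: mult_geMl => c ltc.
rewrite (shift_monomial (fun i => a i ^+ q)) mcoeffX; case: eqP => // eqvc.
suff: (m <= mdeg v)%N by rewrite eqvc leqNgt ltc.
have : (mdeg b <= q * mdeg v + q * N)%N.
  have -> : (q * N = \sum_(i < N) q)%N by rewrite sum_nat_const card_ord mulnC.
  rewrite !mdegE big_distrr /= -big_split /=; apply: leq_sum => i _.
  rewrite mnmE {1}(divn_eq (b i) q) mulnC leq_add2l ltnW //.
  by rewrite ltn_mod.
nia.
Qed.

(** The component carrying the leading monomial is nonzero. Its monomials [w] come from monomials
    [r + q w] of degree [d], so it is homogeneous. *)
Lemma frobenius_descent (p e : nat) (L : fieldType) (charL : p \in [pchar L])
    (N m d : nat) (J : Type) (a : J -> 'I_N -> L) (F : {mpoly L[N]})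
    (q := (p ^ e)%N) :
  F != 0 -> F \is d.-homog -> (forall j, mult_ge (q * (m + N)) (a j) F) ->
  exists (G : {mpoly L[N]}) (t : nat),
    [/\ G != 0, G \is t.-homog, (q * t <= d)%N
      & forall j, mult_ge m (fun i => a j i ^+ q) G].
Proof.
move=> F_neq0 /dhomogP homF hF; have p_pr := pcharf_prime charL.
have q_gt0 : (0 < q)%N by rewrite expn_gt0 prime_gt0.
pose u := mlead F.
pose r := [multinom (u i %% q)%N | i < N]; pose v := [multinom (u i %/ q)%N | i < N].
have eq_u : (r + v *+ q)%MM = u.
  by apply/mnmP=> i; rewrite mnmDE mulmnE !mnmE addnC -divn_eq.
have ltrq i : (r i < q)%N by rewrite mnmE ltn_mod.
exists (frob_comp q r F), ((d - mdeg r) %/ q)%N; split.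
- apply/eqP=> /(congr1 (mcoeff v)); rewrite mcoeff0 mcoeff_frob_comp // eq_u.
  by move/eqP; rewrite mleadc_eq0 (negPf F_neq0).
- apply/dhomogP=> w; rewrite mcoeff_msupp mcoeff_frob_comp // -mcoeff_msupp.
  move/homF; rewrite /= mdegD mdegMn => <-.
  by rewrite addKn mulnK.
- by rewrite mulnC; apply: leq_trans (leq_trunc_div _ _) _; rewrite leq_subr.
- by move=> j; apply: mult_ge_frob.
Qed.

(** * Lower bounds on grids *)

(* [D d] reads "of degree < d" *)
Record degree_filtration (B : comNzRingType) (D : nat -> B -> Prop) : Prop := {
  degree0 : forall b, D 0%N b <-> b = 0;
  degreeW : forall d e b, (d <= e)%N -> D d b -> D e b;
  degreeD : forall d b c, D d b -> D d c -> D d (b + c);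
  degreeM : forall d e b c, D d.+1 b -> D e.+1 c -> D (d + e).+1 (b * c) }.

(** [O m b] reads: of order at least [m], at one point or at several points simultaneously. *)
Record order_filtration (B : comNzRingType) (O : nat -> B -> Prop) : Prop := {
  order0 : forall b, O 0%N b;
  order_zero : forall m, O m 0;
  orderW : forall m k b, (k <= m)%N -> O m b -> O k b;
  orderD : forall m b c, O m b -> O m c -> O m (b + c);
  orderM : forall m k b c, O m b -> O k c -> O (m + k)%N (b * c) }.

(** Total degree after adjoining a variable. For [i >= d] the truncated difference is zero, which
    forces the coefficient to vanish. *)
Definition poly_degree (B : comNzRingType) (D : nat -> B -> Prop) (d : nat)
  (P : {poly B}) : Prop := forall i, D (d - i)%N P`_i.

(** Total order after adjoining a variable centred at [c]. For [i >= m] the truncated difference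
    imposes no condition. *)
Definition poly_order (B : comNzRingType) (O : nat -> B -> Prop) (c : B) (m : nat)
  (P : {poly B}) : Prop := forall i, O (m - i)%N (P \Po ('X + c%:P))`_i.

Section Filtrations.

Variable B : comNzRingType.

Lemma degree_zero (D : nat -> B -> Prop) d : degree_filtration D -> D d 0.
Proof. by move=> fD; apply: (degreeW fD (leq0n d)); apply/(degree0 fD). Qed.

Lemma degreeMz (D : nat -> B -> Prop) d e b c : degree_filtration D ->
  D d b -> D e c -> D (d + e).-1 (b * c).
Proof.
move=> fD; case: d => [/(degree0 fD)->|d] Db.
  by rewrite mul0r; exact: (degree_zero _ fD).
case: e => [/(degree0 fD)->|e Dc]; first by rewrite mulr0; exact: (degree_zero _ fD).
by rewrite addnS; apply: degreeM.
Qed.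

Lemma degree_sum (D : nat -> B -> Prop) d (I : Type) (r : seq I) (P : pred I) F :
  degree_filtration D -> (forall i, P i -> D d (F i)) ->
  D d (\sum_(i <- r | P i) F i).
Proof.
by move=> fD H; apply: big_ind => // [|? ? ? ?]; [apply: degree_zero | apply: degreeD].
Qed.

Lemma order_sum (O : nat -> B -> Prop) m (I : Type) (r : seq I) (P : pred I) F :
  order_filtration O -> (forall i, P i -> O m (F i)) ->
  O m (\sum_(i <- r | P i) F i).
Proof.
by move=> fO H; apply: big_ind => // [|? ? ? ?]; [apply: order_zero | apply: orderD].
Qed.

Lemma orderMl (O : nat -> B -> Prop) m b c : order_filtration O ->
  O m c -> O m (b * c).
Proof. by move=> fO Oc; rewrite -[m]add0n; apply: orderM => //; exact: order0. Qed.

Lemma degree_prod (D : nat -> B -> Prop) (I : Type) (r : seq I) (f : I -> nat) F :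
  degree_filtration D -> D 1%N 1 -> (forall i, D (f i).+1 (F i)) ->
  D (\sum_(i <- r) f i).+1 (\prod_(i <- r) F i).
Proof. by move=> fD D1 H; elim/big_rec2: _ => // i x y _ IH; apply: degreeM. Qed.

Lemma degree_exp (D : nat -> B -> Prop) d b n :
  degree_filtration D -> D 1%N 1 -> D d.+1 b -> D (n * d).+1 (b ^+ n).
Proof.
move=> fD D1 Db; elim: n => [|n IHn]; first by rewrite expr0.
by rewrite exprS mulSn; apply: degreeM.
Qed.

Lemma poly_degree_filtration (D : nat -> B -> Prop) :
  degree_filtration D -> degree_filtration (poly_degree D).
Proof.
move=> fD; split.
- move=> P; split=> [D0|-> i]; last by rewrite coef0; exact: (degree_zero _ fD).
  by apply/polyP=> i; rewrite coef0; apply/(degree0 fD); have := D0 i; rewrite sub0n.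
- by move=> d e P lede DP i; apply: degreeW (DP i); rewrite // leq_sub2r.
- by move=> d P Q DP DQ i; rewrite coefD; apply: degreeD.
move=> d e P Q DP DQ i; rewrite coefM; apply: degree_sum => // j _.
have [ltdj|lejd] := ltnP d j.
  have -> : P`_j = 0.
    by apply/(degree0 fD); have := DP j; rewrite (_ : d.+1 - j = 0)%N //; lia.
  by rewrite mul0r; exact: (degree_zero _ fD).
have [ltei|leie] := ltnP e (i - j).
  have -> : Q`_(i - j) = 0.
    by apply/(degree0 fD); have := DQ (i - j)%N; rewrite (_ : e.+1 - _ = 0)%N //; lia.
  by rewrite mulr0; exact: (degree_zero _ fD).
apply: degreeW (degreeMz fD (DP j) (DQ (i - j)%N)) => //.
have := ltn_ord j; lia.
Qed.

Lemma order_prod (O : nat -> B -> Prop) (I : Type) (r : seq I) (f : I -> nat) F :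
  order_filtration O -> (forall i, O (f i) (F i)) ->
  O (\sum_(i <- r) f i)%N (\prod_(i <- r) F i).
Proof.
move=> fO H; elim/big_rec2: _ => [|i x y _ IH]; last exact: orderM.
exact: order0.
Qed.

Lemma order_exp (O : nat -> B -> Prop) m b n :
  order_filtration O -> O m b -> O (n * m)%N (b ^+ n).
Proof.
move=> fO Ob; elim: n => [|n IHn]; first exact: order0.
by rewrite exprS mulSn; apply: orderM.
Qed.

Lemma poly_degreeC (D : nat -> B -> Prop) d b :
  degree_filtration D -> D d b -> poly_degree D d b%:P.
Proof.
move=> fD Db i; rewrite coefC; case: eqP => [->|_]; first by rewrite subn0.
exact: (degree_zero _ fD).
Qed.

Lemma poly_degreeX (D : nat -> B -> Prop) :
  degree_filtration D -> D 1%N 1 -> poly_degree D 2%N 'X.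
Proof.
move=> fD D1 i; rewrite coefX; case: eqP => [->|_] //; exact: (degree_zero _ fD).
Qed.

Lemma poly_order_filtration (O : nat -> B -> Prop) c :
  order_filtration O -> order_filtration (poly_order O c).
Proof.
move=> fO; split.
- by move=> P i; rewrite sub0n; exact: order0.
- by move=> m i; rewrite comp_poly0 coef0; exact: order_zero.
- by move=> m k P lekm OP i; apply: orderW (OP i); rewrite // leq_sub2r.
- by move=> m P Q OP OQ i; rewrite comp_polyD coefD; apply: orderD.
move=> m k P Q OP OQ i; rewrite comp_polyM coefM; apply: order_sum => // j _.
apply: orderW (orderM fO (OP j) (OQ (i - j)%N)) => //.
have := ltn_ord j; lia.
Qed.

Lemma poly_orderC (O : nat -> B -> Prop) c m b :
  order_filtration O -> O m b -> poly_order O c m b%:P.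
Proof.
move=> fO Ob i; rewrite comp_polyC coefC; case: eqP => [->|_].
  by rewrite subn0.
exact: order_zero.
Qed.

Lemma poly_orderXsubC (O : nat -> B -> Prop) c :
  order_filtration O -> poly_order O c 1%N ('X - c%:P).
Proof.
move=> fO i; rewrite comp_polyB comp_polyX comp_polyC addrK coefX.
by case: i => [|i]; [exact: order_zero | rewrite subSS sub0n; exact: order0].
Qed.

Lemma order_filtration_all (I : Type) (O : I -> nat -> B -> Prop) :
  (forall i, order_filtration (O i)) ->
  order_filtration (fun m b => forall i, O i m b).
Proof.
move=> fO; split.
- by move=> b i; exact: order0.
- by move=> m i; exact: order_zero.
- by move=> m k b lekm Ob i; apply: orderW (Ob i).
- by move=> m b c Ob Oc i; apply: orderD.
- by move=> m k b c Ob Oc i; apply: orderM.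
Qed.

End Filtrations.

(** The ratio [num / den] is a lower bound for the Waldschmidt constant of the points defining [O];
    [D d.+1] means degree at most [d]. *)
Definition order_bound (B : comNzRingType) (D O : nat -> B -> Prop) (num den : nat) :=
  forall b d m, b != 0 -> D d.+1 b -> O m b -> (num * m <= den * d)%N.

(** * Division by linear factors *)

Section Peeling.

Variables (B : idomainType) (D : nat -> B -> Prop).
Hypothesis fD : degree_filtration D.

(** Synthetic division: each coefficient of [Q] is determined by the higher ones, so the induction
    descends from the top. *)
Lemma poly_degree_divXsubC d c (Q : {poly B}) : D 1%N c ->
  poly_degree D d (Q * ('X - c%:P)) -> poly_degree D d.-1 Q.
Proof.
move=> Dc DP i.
have coefQ j : Q`_j = (Q * ('X - c%:P))`_j.+1 + c * Q`_j.+1.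
  by rewrite mulrBr coefB coefMX coefMC /= [c * _]mulrC subrK.
have [k] := ubnP (size Q - i)%N; elim: k i => // k IHk i ltk.
have [le_sz|gt_sz] := leqP (size Q) i.
  by rewrite nth_default //; exact: (degree_zero _ fD).
rewrite coefQ; apply: degreeD => //.
  by apply: degreeW (DP i.+1) => //; lia.
rewrite (_ : d.-1 - i = (1 + (d.-1 - i)).-1)%N; last by lia.
apply: degreeMz => //; apply: degreeW (IHk i.+1 _) => //; lia.
Qed.

Lemma poly_degree_horner d c (P : {poly B}) : D 1%N c ->
  poly_degree D d P -> D d P.[c].
Proof.
move=> Dc DP; rewrite horner_coef; apply: degree_sum => // i _.
have DX k : D 1%N (c ^+ k.+1).
  elim: k => // k IHk; rewrite exprS.
  exact: (@degreeM _ _ fD 0 0).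
have [->|i_neq0] := eqVneq (val i) 0%N.
  by rewrite expr0 mulr1; have := DP 0%N; rewrite subn0.
rewrite -(prednK (n := i)) ?lt0n //.
apply: degreeW (degreeMz fD (DP _) (DX _)) => //; lia.
Qed.

Variable O : nat -> B -> Prop.
Hypothesis fO : order_filtration O.

Lemma poly_order_root m c (P : {poly B}) : poly_order O c m P -> O m P.[c].
Proof.
move/(_ 0%N); rewrite subn0 -horner_coef0 horner_comp.
by rewrite hornerD hornerX hornerC add0r.
Qed.

Lemma poly_order_divXsubC m c (Q : {poly B}) :
  poly_order O c m (Q * ('X - c%:P)) -> poly_order O c m.-1 Q.
Proof.
move=> OP i; have := OP i.+1.
rewrite comp_polyM comp_polyB comp_polyX comp_polyC addrK coefMX /=.
by rewrite (_ : m.-1 - i = m - i.+1)%N //; lia.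
Qed.

(** Near [X = c'] the factor [X - c] is invertible. The coefficients of the shifted [Q] are
    recovered from the lowest upwards, dividing by [c' - c]. *)
Lemma poly_order_div_unit m c c' (Q : {poly B}) : c' - c \is a GRing.unit ->
  poly_order O c' m (Q * ('X - c%:P)) -> poly_order O c' m Q.
Proof.
move=> uc OP i; set Q' := Q \Po ('X + c'%:P).
have coefP j : (c' - c) * Q'`_j = (Q' * ('X + (c' - c)%:P))`_j +
    (-1) * (if j is j'.+1 then Q'`_j' else 0).
  rewrite mulrDr coefD coefMC coefMX mulN1r mulrC.
  by case: j => [|j] /=; rewrite ?add0r ?oppr0 ?addr0 // addrAC subrr add0r.
have {}OP j : O (m - j)%N (Q' * ('X + (c' - c)%:P))`_j.
  have := OP j; rewrite comp_polyM comp_polyB comp_polyX comp_polyC.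
  by rewrite polyCB addrA.
elim: i => [|i IHi]; rewrite -(mulKr uc Q'`__) coefP; apply: orderMl => //.
  by apply: orderD => //; apply: orderMl => //; exact: order_zero.
apply: orderD => //; apply: orderMl => //; apply: orderW IHi => //; lia.
Qed.

End Peeling.

Section PeelHyperplanes.

Variables (B : idomainType) (D : nat -> B -> Prop) (s : nat).
Variables (O : 'I_s -> nat -> B -> Prop) (c : 'I_s -> B) (num : 'I_s -> nat) (den : nat).
Hypotheses (fD : degree_filtration D) (fO : forall i, order_filtration (O i)).
Hypotheses (Dc : forall i, D 1%N (c i)).
Hypothesis c_unit : forall i j, i != j -> c i - c j \is a GRing.unit.
Hypothesis bound : forall i, order_bound D (O i) (num i) den.

(* A hyperplane [X = c i] on which the vanishing orders are too large for the
   degree is contained in the zero set, hence can be split off. *)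
Lemma peel_hyperplanes d (P : {poly B}) (m : 'I_s -> nat) :
  P != 0 -> poly_degree D d.+1 P -> (forall i, poly_order (O i) (c i) (m i) P) ->
  exists e (t : 'I_s -> nat), d = (e + \sum_i t i)%N /\
    forall i, (num i * (m i - t i) <= den * e)%N.
Proof.
elim: d P m => [|d IHd] P m P_neq0 DP OP;
    have [[i Pi0]|noroot] := classic (exists i, P.[c i] = 0); last 1 first.
(* No hyperplane lies in the zero set: the bound applies to each restriction and nothing is split
   off. *)
- exists d.+1, (fun _ => 0%N); split=> [|i]; first by rewrite big1 ?addn0.
  rewrite subn0; apply: (bound (i := i) (b := P.[c i])); last exact: poly_order_root.
    by apply/eqP=> Pi0; apply: noroot; exists i.
  exact: poly_degree_horner.
(* Degree zero leaves no room for a linear factor. *)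
- have /factor_theorem[Q DQ] : root P (c i) by apply/rootP.
  rewrite DQ in DP; have := poly_degree_divXsubC fD (Dc i) DP.
  move/(degree0 (poly_degree_filtration fD)) => Q0.
  by rewrite DQ Q0 mul0r eqxx in P_neq0.
- exists 0%N, (fun _ => 0%N); split=> [|i]; first by rewrite big1.
  rewrite subn0; apply: (bound (i := i) (b := P.[c i])); last exact: poly_order_root.
    by apply/eqP=> Pi0; apply: noroot; exists i.
  exact: poly_degree_horner.
have /factor_theorem[Q DQ] : root P (c i) by apply/rootP.
have Q_neq0 : Q != 0 by apply: contraNneq P_neq0 => Q0; rewrite DQ Q0 mul0r.
rewrite DQ in DP; have /= DPQ := poly_degree_divXsubC fD (Dc i) DP.
pose m' j := if j == i then (m i).-1 else m j.
have OQ j : poly_order (O j) (c j) (m' j) Q.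
  have := OP j; rewrite DQ /m'; case: eqP => [->|/eqP neq_ji] OPj.
    exact: poly_order_divXsubC OPj.
  by apply: poly_order_div_unit OPj => //; apply: c_unit.
have [e [t [Dd le_t]]] := IHd Q m' Q_neq0 DPQ OQ.
exists e, (fun j => t j + (j == i))%N; split=> [|j].
  rewrite big_split /= [X in (_ + (_ + X))%N](_ : _ = 1%N) ?Dd; first by rewrite addn1 addnS.
  by rewrite (bigD1 i) //= eqxx big1 // => j /negPf->.
have := le_t j; rewrite /m'; case: eqP => [->|_].
  by rewrite (_ : m i - (t i + true) = (m i).-1 - t i)%N //; lia.
by rewrite addn0.
Qed.

End PeelHyperplanes.

Section Grid.

Variable K : fieldType.
Hypothesis charK0 : [pchar K] =i pred0.

(** On constants, negative degree and positive order both mean zero. *)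
Let D0 (d : nat) (x : K) := d = 0%N -> x = 0.
Let O0 (m : nat) (x : K) := (0 < m)%N -> x = 0.

Let D0_filtration : degree_filtration D0.
Proof.
split.
- by move=> x; split=> [H|-> //]; exact: H.
- by move=> [|d] [|e] x // _ H _; exact: H.
- by move=> d x y Hx Hy d0; rewrite Hx ?Hy ?addr0.
- by [].
Qed.

Let O0_filtration : order_filtration O0.
Proof.
split=> //.
- by move=> m k x lekm Ox ltk; apply: Ox; apply: leq_trans lekm.
- by move=> m x y Hx Hy d0; rewrite Hx ?Hy ?addr0.
move=> m k x y Ox Oy; rewrite /O0 addn_gt0 => /orP[/Ox->|/Oy->].
  by rewrite mul0r.
by rewrite mulr0.
Qed.

Let D1 := poly_degree D0.
Let D2 := poly_degree D1.
Let D3 := poly_degree D2.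
Let D1_filtration : degree_filtration D1.
Proof. exact: poly_degree_filtration. Qed.
Let D2_filtration : degree_filtration D2.
Proof. exact: poly_degree_filtration. Qed.
Let D3_filtration : degree_filtration D3.
Proof. exact: poly_degree_filtration. Qed.

(** [O1 n] concerns the points [0, ..., n - 1] of a line, [O2 s nu] the points [(x, y)] of a plane
    with [y < s] and [x < nu y]. *)
Let O1 (n : nat) (m : nat) (P : {poly K}) : Prop :=
  forall x : 'I_n, poly_order O0 x%:R m P.
Let O2 (s : nat) (nu : nat -> nat) (m : nat) (P : {poly {poly K}}) : Prop :=
  forall y : 'I_s, poly_order (O1 (nu y)) y%:R m P.

Let O1_filtration n : order_filtration (O1 n).
Proof. by apply: order_filtration_all => x; exact: poly_order_filtration. Qed.
Let O2_filtration s nu : order_filtration (O2 s nu).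
Proof. by apply: order_filtration_all => y; exact: poly_order_filtration. Qed.

Lemma natr_sub_unit (i j : nat) : i != j -> (i%:R - j%:R : K) \is a GRing.unit.
Proof.
have neq0 k : (0 < k)%N -> (k%:R != 0 :> K).
  by have /pcharf0P -> := charK0; rewrite lt0n.
rewrite unitfE; case: ltngtP => // lt _.
  by rewrite -opprB oppr_eq0 -natrB 1?ltnW // neq0 ?subn_gt0.
by rewrite -natrB 1?ltnW // neq0 ?subn_gt0.
Qed.

Lemma natr_sub_poly_unit (B : idomainType) (i j : nat) :
  (i%:R - j%:R : B) \is a GRing.unit ->
  (i%:R - j%:R : {poly B}) \is a GRing.unit.
Proof. by move=> u; rewrite -!polyC_natr -polyCB rmorph_unit. Qed.

Lemma line_bound n : order_bound D1 (O1 n) n 1.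
Proof.
move=> P d m P_neq0 DP OP; rewrite mul1n.
(* A nonzero constant has order zero, so any slope is allowed; [d.+1] exceeds the remaining degree
   and thereby forces [m <= t i]. *)
have bnd (i : 'I_n) : order_bound D0 O0 d.+1 1.
  move=> b e k b_neq0 _ Ob; case: k Ob => [|k] Ob; first by rewrite muln0.
  by rewrite Ob ?eqxx in b_neq0.
have Dc (i : 'I_n) : D0 1 i%:R by [].
have uc (i j : 'I_n) : i != j -> i%:R - j%:R \is a @GRing.unit K.
  exact: natr_sub_unit.
have [e [t [Dd le_t]]] := peel_hyperplanes (m := fun _ => m)
  D0_filtration (fun _ => O0_filtration) Dc uc bnd P_neq0 DP OP.
suff : (\sum_(i < n) m <= \sum_(i < n) t i)%N.
  rewrite sum_nat_const card_ord Dd => H; apply: leq_trans H _; exact: leq_addl.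
apply: leq_sum => i _; have := le_t i; rewrite mul1n Dd -[in X in _ -> X]subn_eq0.
case: (m - t i)%N => // k; nia.
Qed.

(** Splitting off the lines [y = const] leaves a curve of degree [e] containing none of them;
    restricted to each line, it reduces the claim to arithmetic. *)
Lemma plane_bound s (nu : nat -> nat) num den :
  (forall m e (t : 'I_s -> nat), (forall y : 'I_s, nu y * (m - t y) <= e)%N ->
     (num * m <= den * (e + \sum_y t y))%N) ->
  order_bound D2 (O2 s nu) num den.
Proof.
move=> arith P d m P_neq0 DP OP.
have Dc (i : 'I_s) : D1 1 i%:R by rewrite -polyC_natr; apply: poly_degreeC.
have uc (i j : 'I_s) : i != j -> i%:R - j%:R \is a @GRing.unit {poly K}.
  by move=> neq_ij; apply/natr_sub_poly_unit/natr_sub_unit.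
have [e [t [-> le_t]]] := peel_hyperplanes (m := fun _ => m) D1_filtration
  (fun y : 'I_s => O1_filtration (nu y)) Dc uc (fun y : 'I_s => @line_bound (nu y))
  P_neq0 DP OP.
by apply: arith => y; have := le_t y; rewrite mul1n.
Qed.

(** Sum [num * m <= num * t y + den * e] over the [s] hyperplanes, use [num <= s * den] and cancel
    [s]. *)
Lemma parallel_bound s num den m e (t : 'I_s -> nat) : (0 < s)%N ->
  (num <= s * den)%N -> (forall y, num * (m - t y) <= den * e)%N ->
  (num * m <= den * (e + \sum_y t y))%N.
Proof.
move=> s_gt0 le_num le_t.
have : (\sum_(y < s) num * m <= \sum_(y < s) (num * t y + den * e))%N.
  by apply: leq_sum => y _; have := le_t y; nia.
rewrite big_split /= !sum_nat_const card_ord.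
set T := (\sum_i t i)%N => le1.
have le2 : (num * T <= s * den * T)%N by rewrite leq_mul2r le_num orbT.
rewrite -(leq_pmul2l s_gt0); apply: leq_trans le1 _.
by rewrite !mulnDr !mulnA addnC leq_add2l -big_distrr.
Qed.

Lemma space_bound r s (nu : nat -> nat) num den (O3 := fun m (P : {poly {poly {poly K}}}) =>
    forall z : 'I_r, poly_order (O2 s nu) z%:R m P) :
  (0 < r)%N -> (num <= r * den)%N -> order_bound D2 (O2 s nu) num den ->
  order_bound D3 O3 num den.
Proof.
move=> r_gt0 le_num bnd P d m P_neq0 DP OP.
have Dc (i : 'I_r) : D2 1 i%:R.
  rewrite -polyC_natr; apply: (poly_degreeC D1_filtration).
  by rewrite -polyC_natr; apply: (poly_degreeC D0_filtration).
have uc (i j : 'I_r) : i != j -> i%:R - j%:R \is a @GRing.unit {poly {poly K}}.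
  by move=> neq_ij; apply/natr_sub_poly_unit/natr_sub_poly_unit/natr_sub_unit.
have [e [t [-> le_t]]] := peel_hyperplanes (m := fun _ => m) D2_filtration
  (fun _ => O2_filtration s nu) Dc uc (fun _ => bnd) P_neq0 DP OP.
exact: parallel_bound.
Qed.

(** * Dehomogenization to nested polynomial rings *)

Definition affine_coord (i : 'I_4) : {poly {poly {poly K}}} :=
  [:: 1; 'X%:P%:P; 'X%:P; 'X]`_i.

Definition dehomogenize : {mpoly K[4]} -> {poly {poly {poly K}}} :=
  mmap (polyC \o (polyC \o polyC)) affine_coord.

HB.instance Definition _ := GRing.RMorphism.copy dehomogenize
  (mmap (polyC \o (polyC \o polyC)) affine_coord).

Lemma dehomogenizeX i : dehomogenize 'X_i = affine_coord i.
Proof. by rewrite /dehomogenize mmapX mmap1U. Qed.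

Lemma dehomogenizeC c : dehomogenize c%:MP = c%:P%:P%:P.
Proof. by rewrite /dehomogenize mmapC. Qed.

Lemma dehomogenizeZ c F : dehomogenize (c *: F) = c%:P%:P%:P * dehomogenize F.
Proof. by rewrite /dehomogenize mmapZ. Qed.

Lemma inord4_lift : [/\ inord 1 = lift ord0 ord0 :> 'I_4,
    inord 2 = lift ord0 (lift ord0 ord0) :> 'I_4
  & inord 3 = lift ord0 (lift ord0 (lift ord0 ord0)) :> 'I_4].
Proof. by split; apply: val_inj; rewrite /= inordK. Qed.

Lemma dehomogenize_coef (b : 'X_{1..4}) (i j k : nat) :
  (((dehomogenize 'X_[b])`_k)`_j)`_i =
    ((i == b (inord 1)) && (j == b (inord 2)) && (k == b (inord 3)))%:R.
Proof.
have [-> -> ->] := inord4_lift.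
rewrite mpolyXE_id rmorph_prod /= !big_ord_recl big_ord0 /= !rmorphXn /= !dehomogenizeX.
rewrite /affine_coord /= expr1n mul1r mulr1 mulrA.
rewrite -!rmorphXn /= -rmorphM /= coefCM coefXn mulr_natr coefMn.
rewrite coefCM coefXn mulr_natr !coefMn coefXn.
by do 3 case: eqP.
Qed.

(** In a form of fixed degree the exponent of [x_0] is determined by the other three, so setting
    [x_0 = 1] causes no cancellation. *)
Lemma dehomogenize_neq0 d F : F != 0 -> F \is d.-homog -> dehomogenize F != 0.
Proof.
move=> F_neq0 /dhomogP homF; pose u := mlead F.
have u_supp : u \in msupp F by apply: mlead_supp.
suff : (((dehomogenize F)`_(u (inord 3)))`_(u (inord 2)))`_(u (inord 1)) != 0.
  by apply: contraNneq => ->; rewrite !coef0.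
rewrite [F in dehomogenize F]mpolyE raddf_sum /= !coef_sum (bigD1_seq u) //=.
rewrite big_seq_cond big1 => [|b /andP[b_supp neq_bu]].
  rewrite addr0 dehomogenizeZ !coefCM dehomogenize_coef !eqxx mulr1.
  by rewrite -mcoeff_msupp.
rewrite dehomogenizeZ !coefCM dehomogenize_coef.
case: andP => [[/andP[/eqP e1 /eqP e2] /eqP e3]|]; last by rewrite mulr0.
have [E1 E2 E3] := inord4_lift.
have := homF _ b_supp; rewrite -(homF _ u_supp) /= !mdegE !big_ord_recl !big_ord0.
rewrite -E1 -E2 -E3 e1 e2 e3 => /addIn e0.
case/eqP: neq_bu; apply/mnmP=> i.
case: (unliftP ord0 i) => [i1|] -> //.
case: (unliftP ord0 i1) => [i2|] ->; last by rewrite -E1.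
case: (unliftP ord0 i2) => [i3|] ->; last by rewrite -E2.
by rewrite [i3]ord1 -E3.
Qed.

Let D0_1 : D0 1%N 1. Proof. by []. Qed.
Let D1_1 : D1 1%N 1. Proof. exact: (poly_degreeC D0_filtration D0_1). Qed.
Let D2_1 : D2 1%N 1. Proof. exact: (poly_degreeC D1_filtration D1_1). Qed.
Let D3_1 : D3 1%N 1. Proof. exact: (poly_degreeC D2_filtration D2_1). Qed.

Lemma affine_coord_degree i : D3 2%N (affine_coord i).
Proof.
case: i => -[|[|[|[|//]]]] lti.
- exact: (@degreeW _ D3 D3_filtration 1 2 1 isT D3_1).
- exact: (poly_degreeC D2_filtration
    (poly_degreeC D1_filtration (poly_degreeX D0_filtration D0_1))).
- exact: (poly_degreeC D2_filtration (poly_degreeX D1_filtration D1_1)).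
- exact: (poly_degreeX D2_filtration D2_1).
Qed.

Lemma dehomogenize_degree d F : F \is d.-homog -> D3 d.+1 (dehomogenize F).
Proof.
move=> /dhomogP homF; rewrite [F in dehomogenize F]mpolyE raddf_sum big_seq.
apply: (degree_sum _ D3_filtration) => b /homF <-; rewrite /= dehomogenizeZ -[mdeg b]add0n.
apply: (degreeM D3_filtration).
  exact: (poly_degreeC D2_filtration
    (poly_degreeC D1_filtration (poly_degreeC D0_filtration _))).
rewrite mpolyXE_id rmorph_prod mdegE; apply: (degree_prod _ D3_filtration) => // i.
rewrite rmorphXn /= dehomogenizeX -[X in D3 X.+1 _]muln1.
exact: (@degree_exp _ D3 1 _ _ D3_filtration D3_1 (affine_coord_degree i)).
Qed.

Definition affine_point (x y z : K) (i : 'I_4) : K := [:: 1; x; y; z]`_i.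

(** In the Taylor expansion, [x_0 - 1] becomes zero, which has every order, and the other three
    linear factors have order one at the point. *)
Lemma dehomogenize_order m x y z F :
  mult_ge m (affine_point x y z) F ->
  poly_order (poly_order (poly_order O0 x) y%:P) z%:P%:P m (dehomogenize F).
Proof.
move=> /mult_geP hF.
have f1 : order_filtration (poly_order O0 x) by exact: poly_order_filtration.
have f2 : order_filtration (poly_order (poly_order O0 x) y%:P).
  exact: poly_order_filtration.
have f3 : order_filtration (poly_order (poly_order (poly_order O0 x) y%:P) z%:P%:P).
  exact: poly_order_filtration.
rewrite [F](taylor (affine_point x y z)) raddf_sum big_seq.
apply: (order_sum _ f3) => b /hF leb; apply: (orderW f3 leb).
rewrite /= dehomogenizeZ; apply: (orderMl _ f3).
rewrite rmorph_prod mdegE; apply: (order_prod _ f3) => i.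
rewrite rmorphXn rmorphB /= dehomogenizeX dehomogenizeC.
rewrite -[X in poly_order _ _ X _]muln1; apply: (order_exp _ f3).
case: i => -[|[|[|[|//]]]] lti.
- have -> : affine_coord (Ordinal lti) = 1 by [].
  have -> : affine_point x y z (Ordinal lti) = 1 by [].
  by rewrite !polyC1 subrr; exact: (order_zero f3).
- have -> : affine_coord (Ordinal lti) = 'X%:P%:P by [].
  have -> : affine_point x y z (Ordinal lti) = x by [].
  rewrite -2!polyCB.
  exact: (@poly_orderC _ _ _ 1 _ f2
    (@poly_orderC _ _ _ 1 _ f1 (poly_orderXsubC _ O0_filtration))).
- have -> : affine_coord (Ordinal lti) = 'X%:P by [].
  have -> : affine_point x y z (Ordinal lti) = y by [].
  rewrite -polyCB.
  exact: (@poly_orderC _ _ _ 1 _ f2 (poly_orderXsubC _ f1)).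
- have -> : affine_coord (Ordinal lti) = 'X by [].
  have -> : affine_point x y z (Ordinal lti) = z by [].
  exact: (poly_orderXsubC _ f2).
Qed.

Lemma staircase_bound r s (nu : nat -> nat) num den d m F :
  (0 < r)%N -> (num <= r * den)%N ->
  (forall m e (t : 'I_s -> nat), (forall y : 'I_s, nu y * (m - t y) <= e)%N ->
     (num * m <= den * (e + \sum_y t y))%N) ->
  F != 0 -> F \is d.-homog ->
  (forall x y z, (x < nu y)%N -> (y < s)%N -> (z < r)%N ->
     mult_ge m (affine_point x%:R y%:R z%:R) F) ->
  (num * m <= den * d)%N.
Proof.
move=> r_gt0 le_num arith F_neq0 homF hF.
apply: (space_bound r_gt0 le_num (plane_bound arith)
  (dehomogenize_neq0 F_neq0 homF) (dehomogenize_degree homF)) => z i y j x k.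
have := dehomogenize_order (hF _ _ _ (ltn_ord x) (ltn_ord y) (ltn_ord z)).
by move/(_ i j k); rewrite !polyC_natr.
Qed.

(** Parallel lines and then parallel planes preserve the slope [k] of [k] points on a line. Powers
    of a product of [k] parallel planes attain the bound. *)
Lemma grid_bound k d m F : (0 < k)%N -> F != 0 -> F \is d.-homog ->
  (forall x y z, (x < k)%N -> (y < k)%N -> (z < k)%N ->
     mult_ge m (affine_point x%:R y%:R z%:R) F) ->
  (k * m <= d)%N.
Proof.
move=> k_gt0 F_neq0 homF hF; rewrite -[d]mul1n.
apply: (staircase_bound (r := k) (s := k) (nu := fun _ => k)) F_neq0 homF hF => //.
  by rewrite muln1.
by move=> m' e t le_t; apply: parallel_bound => // [|y]; rewrite ?muln1 ?mul1n.
Qed.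

(* Three planes, each carrying lines with 3, 2 and 1 of the points. *)
Lemma triangle_bound d m F : F != 0 -> F \is d.-homog ->
  (forall x y z, (x < 3 - y)%N -> (y < 3)%N -> (z < 3)%N ->
     mult_ge m (affine_point x%:R y%:R z%:R) F) ->
  (13 * m <= 6 * d)%N.
Proof.
move=> F_neq0 homF hF.
apply: (staircase_bound (r := 3) (s := 3) (nu := fun y => (3 - y)%N)) F_neq0 homF hF => //.
(* The lines give [3(m - t_0) <= e], [2(m - t_1) <= e] and [m - t_2 <= e]. Then
   [13 m <= 6(e + t_0 + t_1 + t_2)] follows by adding [6m <= 6 t_0 + 2e], [6m <= 6 t_1 + 3e] and
   [m <= t_2 + e]. *)
move=> m' e t le_t; rewrite !big_ord_recl big_ord0 addn0.
have := le_t ord0; have := le_t (lift ord0 ord0).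
have := le_t (lift ord0 (lift ord0 ord0)); rewrite /= /bump /=; lia.
Qed.

End Grid.

(** * The interpolation matrix *)

Section Multidegree.

Variables (K : fieldType) (n N : nat).
Local Notation A := {mpoly K[n * N.+1]}.
Implicit Types (d e : 'I_n -> nat) (F G : A).

Definition multidegree (mon : 'X_{1..(n * N.+1)}) (j : 'I_n) : nat :=
  (\sum_(i < N.+1) mon (mxvec_index j i))%N.

Definition of_multidegree d F : Prop :=
  forall mon, mon \in msupp F -> forall j, multidegree mon j = d j.

Lemma of_multidegree_multihomog d F : of_multidegree d F -> multihomog F.
Proof. by move=> dF; exists d. Qed.

Lemma multidegree0 j : multidegree 0%MM j = 0%N.
Proof. by rewrite /multidegree big1 // => i _; rewrite mnm0E. Qed.

Lemma multidegreeD mon mon' j :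
  multidegree (mon + mon')%MM j = (multidegree mon j + multidegree mon' j)%N.
Proof.
by rewrite /multidegree -big_split; apply: eq_bigr => i _; rewrite mnmDE.
Qed.

Lemma mxvec_index_eq (j j' : 'I_n) (i i' : 'I_N.+1) :
  (mxvec_index j i == mxvec_index j' i') = (j == j') && (i == i').
Proof.
apply/eqP/andP=> [eq_ix|[/eqP-> /eqP->] //].
(* Entries of an elementary matrix detect equality of encoded index pairs. *)
have := mxvecE (delta_mx j' i' : 'M[int]_(n, N.+1)) j i.
rewrite eq_ix mxvecE !mxE !eqxx /=.
by case: (j == j') => //; case: (i == i').
Qed.

Lemma multidegree1 j i j' : multidegree U_(mxvec_index j i)%MM j' = (j' == j).
Proof.
rewrite /multidegree (bigD1 i) //= mnm1E mxvec_index_eq eqxx andbT eq_sym.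
rewrite big1 ?addn0 // => i' /negPf ne.
by rewrite mnm1E mxvec_index_eq [i == i']eq_sym ne andbF.
Qed.

Lemma of_multidegree_zero d : of_multidegree d 0.
Proof. by move=> mon; rewrite msupp0. Qed.

Lemma of_multidegreeC c : of_multidegree (fun _ => 0%N) c%:MP.
Proof.
move=> mon; rewrite msuppC; case: eqP => // _; rewrite inE => /eqP -> j.
exact: multidegree0.
Qed.

Lemma of_multidegreeX j i :
  of_multidegree (fun j' => (j' == j) : nat) 'X_(mxvec_index j i).
Proof. by move=> mon; rewrite msuppX inE => /eqP -> j'; exact: multidegree1. Qed.

Lemma of_multidegreeD d F G :
  of_multidegree d F -> of_multidegree d G -> of_multidegree d (F + G).
Proof.
by move=> dF dG mon /msuppD_le; rewrite mem_cat => /orP[/dF|/dG].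
Qed.

Lemma of_multidegreeM d e F G :
  of_multidegree d F -> of_multidegree e G ->
  of_multidegree (fun j => d j + e j)%N (F * G).
Proof.
move=> dF eG mon /msuppM_le /allpairsP[[m1 m2] [/= /dF d1 /eG d2 ->]] j.
by rewrite multidegreeD d1 d2.
Qed.

Lemma of_multidegree_sum d (I : Type) (r : seq I) (P : pred I) (F : I -> A) :
  (forall i, P i -> of_multidegree d (F i)) ->
  of_multidegree d (\sum_(i <- r | P i) F i).
Proof.
move=> H; apply: big_ind => // [|? ? ? ?]; [exact: of_multidegree_zero|].
exact: of_multidegreeD.
Qed.

Lemma of_multidegree_prod (I : Type) (r : seq I) (d : I -> 'I_n -> nat) (F : I -> A) :
  (forall i, of_multidegree (d i) (F i)) ->
  of_multidegree (fun j => \sum_(i <- r) d i j)%N (\prod_(i <- r) F i).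
Proof.
move=> H; elim: r => [|i r IHr] mon.
  by rewrite big_nil -mpolyC1 => /of_multidegreeC H1 j; rewrite big_nil H1.
by rewrite big_cons => /(of_multidegreeM (H i) IHr) H1 j; rewrite big_cons H1.
Qed.

(** With a common multidegree along each row, all terms of the Leibniz expansion have the same
    multidegree. *)
Lemma of_multidegree_det k (d : 'I_k -> 'I_n -> nat) (M : 'M[A]_k) :
  (forall i l, of_multidegree (d i) (M i l)) ->
  of_multidegree (fun j => \sum_i d i j)%N (\det M).
Proof.
move=> H; apply: of_multidegree_sum => s _.
have sgn (b : nat) : of_multidegree (fun _ => 0%N) ((-1) ^+ b : A).
  by rewrite -mpolyC1 -mpolyCN -rmorphXn; exact: of_multidegreeC.
have prd : of_multidegree (fun j => \sum_i d i j)%N (\prod_i M i (s i)).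
  exact: of_multidegree_prod.
by move=> mon /(of_multidegreeM (sgn _) prd) e j; rewrite e.
Qed.

Definition generic_point (j : 'I_n) (i : 'I_N.+1) : A := 'X_(mxvec_index j i).

(* [Q] is homogeneous of degree [d] when its variables and the coordinates of
   the [j]-th generic point are both given degree one. *)
Definition taylor_homog (j : 'I_n) (d : nat) (Q : {mpoly A[N.+1]}) : Prop :=
  forall b mon, mon \in msupp Q@_b -> forall j',
    (multidegree mon j' + (j' == j) * mdeg b = (j' == j) * d)%N.

Lemma taylor_homogM j (d e : nat) P Q :
  taylor_homog j d P -> taylor_homog j e Q -> taylor_homog j (d + e) (P * Q).
Proof.
move=> hP hQ b mon; rewrite mcoeffM => /msupp_sum_le /flattenP[s /mapP[[b1 b2]]].
rewrite mem_filter /= => /andP[/eqP Db _] -> /msuppM_le.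
case/allpairsP=> -[m1 m2] [/= /hP h1 /hQ h2 ->] j'.
rewrite Db mdegD multidegreeD; have := h1 j'; have := h2 j'; nia.
Qed.

(** Each factor [x_i + a_i] is homogeneous of degree one for this grading. Hence the Taylor
    coefficient at [b] has degree [|u| - |b|] in the coordinates of the [j]-th point. *)
Lemma taylor_homog_shiftX j (u : 'X_{1..N.+1}) :
  taylor_homog j (mdeg u) (shift (generic_point j) 'X_[u]).
Proof.
have one : taylor_homog j 0 1.
  move=> b mon; rewrite mcoeff1; case: eqP => [->|_]; last by rewrite msupp0.
  by rewrite -mpolyC1 => /of_multidegreeC H j'; rewrite H mdeg0 muln0.
have linear i : taylor_homog j 1 ('X_i + (generic_point j i)%:MP).
  move=> b mon; rewrite mcoeffD mcoeffX mcoeffC => /msuppD_le; rewrite mem_cat.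
  case/orP.
    case: eqP => [<-|_]; last by rewrite msupp0.
    by rewrite -mpolyC1 => /of_multidegreeC H j'; rewrite H mdeg1 muln1.
  case: eqP => [->|_]; last by rewrite mulr0 msupp0.
  by rewrite mulr1 mdeg0 => /of_multidegreeX H j'; rewrite H muln0 addn0 muln1.
rewrite mpolyXE_id rmorph_prod mdegE.
elim/big_rec2: _ => // i x y _ IH; apply: taylor_homogM => //.
rewrite rmorphXn /= shiftX; elim: (u i) => // k IHk.
by rewrite exprS -add1n; apply: taylor_homogM.
Qed.

End Multidegree.

Section Interpolation.

Variables (N n k D : nat).

Definition condition : finType := ('I_n * 'X_{1..N < k})%type.
(** The bound [D.+1] serves to make the type finite. *)
Definition form_monomial : finType := {u : 'X_{1..N < D.+1} | mdeg u == D}.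

Definition interpolation_mx (R : comNzRingType) (a : 'I_n -> 'I_N -> R) :
    'M[R]_(#|condition|, #|form_monomial|) :=
  \matrix_(r, c) (shift (a (enum_val r).1) 'X_[val (val (enum_val c))])
                   @_(val (enum_val r).2).

Definition form_coefs (R : comNzRingType) (F : {mpoly R[N]}) :
    'cV[R]_#|form_monomial| := \col_c F@_(val (val (enum_val c))).

Lemma map_interpolation_mx (R S : comNzRingType) (f : {rmorphism R -> S}) a :
  map_mx f (interpolation_mx a) = interpolation_mx (fun j => f \o a j).
Proof.
by apply/matrixP=> r c; rewrite !mxE -mcoeff_map_mpoly map_shift map_mpolyX.
Qed.

Lemma mcoeff_form_sum (R : comNzRingType) (v : 'cV[R]_#|form_monomial|) c :
  (\sum_c' v c' 0 *: 'X_[val (val (enum_val c'))])@_(val (val (enum_val c))) = v c 0.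
Proof.
rewrite raddf_sum (bigD1 c) //= big1 => [|c' neq_c].
  by rewrite addr0 mcoeffZ mcoeffX eqxx mulr1.
rewrite mcoeffZ mcoeffX; case: eqP => [equ|_]; last by rewrite mulr0.
by case/eqP: neq_c; apply: enum_val_inj; apply: val_inj; apply: val_inj.
Qed.

Lemma form_sum_homog (R : comNzRingType) (v : 'cV[R]_#|form_monomial|) :
  \sum_c v c 0 *: 'X_[val (val (enum_val c))] \is [in R[N], D.-homog].
Proof.
apply: rpred_sum => c _; apply: dhomogZ; rewrite dhomogX; exact: (valP (enum_val c)).
Qed.

Lemma form_sum (R : comNzRingType) (F : {mpoly R[N]}) : F \is D.-homog ->
  F = \sum_c form_coefs F c 0 *: 'X_[val (val (enum_val c))].
Proof.
move=> /dhomogP homF; apply/mpolyP=> u.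
have [eq_u|neq_u] := eqVneq (mdeg u) D; last first.
  rewrite memN_msupp_eq0; last by apply/negP=> /homF eq_u; rewrite eq_u eqxx in neq_u.
  rewrite raddf_sum big1 //= => c _; rewrite mcoeffZ mcoeffX.
  case: eqP => [eq_c|_]; last by rewrite mulr0.
  by case/eqP: neq_u; rewrite -eq_c; apply/eqP; exact: (valP (enum_val c)).
have lt_u : (mdeg u < D.+1)%N by rewrite eq_u.
have eq_u' : mdeg (BMultinom lt_u) == D by rewrite /= eq_u.
pose c0 := enum_rank (exist (fun u : 'X_{1..N < D.+1} => mdeg u == D) _ eq_u' : form_monomial).
have -> : u = val (val (enum_val c0)) by rewrite enum_rankK.
by rewrite mcoeff_form_sum mxE.
Qed.

Lemma interpolation_mxE (R : comNzRingType) (a : 'I_n -> 'I_N -> R)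
    (v : 'cV[R]_#|form_monomial|) r :
  (interpolation_mx a *m v) r 0 =
  (shift (a (enum_val r).1) (\sum_c v c 0 *: 'X_[val (val (enum_val c))]))
    @_(val (enum_val r).2).
Proof.
rewrite (linear_sum (shift _)) raddf_sum mxE; apply: eq_bigr => c _ /=.
by rewrite linearZ mcoeffZ mulrC !mxE.
Qed.

Lemma interpolation_mxP (R : comNzRingType) (a : 'I_n -> 'I_N -> R)
    (v : 'cV[R]_#|form_monomial|) :
  (forall j, mult_ge k (a j) (\sum_c v c 0 *: 'X_[val (val (enum_val c))])) <->
  interpolation_mx a *m v = 0.
Proof.
split=> [multF|M0 j b ltb].
  apply/colP=> r; rewrite interpolation_mxE mxE; apply: multF; exact: bmdeg.
pose r := enum_rank ((j, BMultinom ltb) : condition).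
by have := interpolation_mxE a v r; rewrite M0 mxE enum_rankK.
Qed.

Definition interpolation_minor (R : comNzRingType)
    (f : 'I_#|form_monomial| -> 'I_#|condition|) (a : 'I_n -> 'I_N -> R) : R :=
  \det (rowsub f (interpolation_mx a)).

Lemma rmorph_interpolation_minor (R S : comNzRingType) (g : {rmorphism R -> S}) f a :
  g (interpolation_minor f a) = interpolation_minor f (fun j => g \o a j).
Proof. by rewrite /interpolation_minor -det_map_mx map_mxsub map_interpolation_mx. Qed.

Lemma interpolation_minor_neq0 (L : fieldType) f (a : 'I_n -> 'I_N -> L)
    (F : {mpoly L[N]}) :
  interpolation_minor f a != 0 -> F \is D.-homog ->
  (forall j, mult_ge k (a j) F) -> F = 0.
Proof.
move=> minor_neq0 homF; rewrite (form_sum homF) => /interpolation_mxP M0.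
have u : rowsub f (interpolation_mx a) \in unitmx by rewrite unitmxE unitfE.
have v0 : form_coefs F = 0.
  rewrite -(mulKmx u (form_coefs F)) mul_rowsub_mx M0.
  by rewrite (_ : rowsub f 0 = 0) ?mulmx0 //; apply/matrixP=> i j; rewrite !mxE.
by rewrite big1 // => c _; rewrite v0 mxE scale0r.
Qed.

(** The kernel of the matrix is zero, so its column rank is full and some choice of rows is
    invertible. *)
Lemma exists_interpolation_minor (L : fieldType) (a : 'I_n -> 'I_N -> L) :
  (forall F : {mpoly L[N]}, F \is D.-homog ->
     (forall j, mult_ge k (a j) F) -> F = 0) ->
  exists f, interpolation_minor f a != 0.
Proof.
move=> noF; suff fullM : row_full (interpolation_mx a).
  exists (fullrankfun fullM); rewrite -unitfE -unitmxE; exact: fullrowsub_unit.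
rewrite /row_full -mxrank_tr; apply: inj_row_free => v v0.
have /interpolation_mxP/(noF _ (form_sum_homog _)) F0 : interpolation_mx a *m v^T = 0.
  by apply: trmx_inj; rewrite trmx_mul trmxK v0 trmx0.
apply/rowP=> c; have := mcoeff_form_sum v^T c.
by rewrite F0 mcoeff0 !mxE.
Qed.

End Interpolation.

(** The row of the condition of order [b] at the [j]-th point has degree [D - |b|] in that point and
    zero in the others. If [|b| > D], the row vanishes. *)
Lemma interpolation_minor_multihomog (K : fieldType) (N n k D : nat) f :
  multihomog (interpolation_minor (k := k) (D := D) f (@generic_point K n N)).
Proof.
pose d i (j : 'I_n) := ((j == (enum_val (f i)).1) * (D - mdeg (val (enum_val (f i)).2)))%N.
apply: (@of_multidegree_multihomog _ _ _ (fun j => \sum_i d i j)%N).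
apply: of_multidegree_det => i l mon; rewrite !mxE => mon_supp j.
have /eqP DE := valP (enum_val l).
have := taylor_homog_shiftX mon_supp j; rewrite DE /d.
case: (j == _) => /=; rewrite ?mul1n ?mul0n ?addn0 // => <-.
by rewrite addnK.
Qed.

Lemma eval_interpolation_minor (K : fieldType) (N n k D : nat) f
    (p : 'I_n -> point K N) :
  eval_points p (interpolation_minor (k := k) (D := D) f (@generic_point K n N)) =
  interpolation_minor f (fun j => Defs.coord (p j)).
Proof.
rewrite /eval_points rmorph_interpolation_minor; congr (interpolation_minor f _).
apply: functional_extensionality => j; apply: functional_extensionality => i.
by rewrite /= mevalXU mxvecE mxE.
Qed.

(** * Symbolic powers and initial degrees *)

Lemma mcoeff0_shift (R : comNzRingType) (N : nat) (a : 'I_N -> R) (F : {mpoly R[N]}) :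
  (shift a F)@_0%MM = F.@[a].
Proof.
rewrite shiftE raddf_sum mevalE; apply: eq_bigr => b _ /=.
rewrite mcoeffZ mpolyXE_id !rmorph_prod; congr (_ * _); apply: eq_bigr => i _ /=.
by rewrite !rmorphXn /= shiftX mcoeffD mcoeffX mnm1_eq0 mcoeffC eqxx add0r mulr1.
Qed.

Section Ideals.

Variables (K : fieldType) (N : nat).

Lemma point_ideal_mult_ge (p : point K N) f :
  point_ideal p f -> mult_ge 1 (Defs.coord p) f.
Proof.
move=> [r [c [g [Hg ->]]]]; apply: mult_ge_sum => k _; apply: mult_geMl => b.
by rewrite ltnS leqn0 mdeg_eq0 => /eqP ->; rewrite mcoeff0_shift; have [] := Hg k.
Qed.

Lemma symbolic_power_mult_ge n (p : 'I_n -> point K N) m f :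
  symbolic_power p m f -> forall j, mult_ge m (Defs.coord (p j)) f.
Proof.
move=> Hf j; have [r [c [g [Hg ->]]]] := Hf j; apply: mult_ge_sum => k _.
apply: mult_geMl; have [h [Hh ->]] := Hg k.
rewrite -[m in mult_ge m]card_ord -sum1_card.
by apply: mult_ge_prod => i; apply: point_ideal_mult_ge.
Qed.

Lemma point_ideal_form (p : point K N) d (F : {mpoly K[N.+1]}) :
  F \is d.-homog -> F.@[Defs.coord p] = 0 -> point_ideal p F.
Proof.
move=> homF F0; exists 1%N, (fun _ => 1), (fun _ => F); split=> [_|].
  by split=> //; exists d.
by rewrite big_ord1 mul1r.
Qed.

Lemma symbolic_powerX n (p : 'I_n -> point K N) m F :
  points_ideal p F -> symbolic_power p m (F ^+ m).
Proof.
move=> IF j; exists 1%N, (fun _ => 1), (fun _ => F ^+ m); split=> [_|].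
  by exists (fun _ => F); split=> //; rewrite prodr_const card_ord.
by rewrite big_ord1 mul1r.
Qed.

Lemma leq_card_form_monomial a : ('C(a + N, a) <= #|form_monomial N.+1 a|)%N.
Proof.
rewrite -size_basis cardE.
rewrite -[X in (_ <= X)%N](size_map (fun u : form_monomial N.+1 a => val (val u))).
apply: uniq_leq_size.
  exact: uniq_basis.
move=> u; rewrite -basis_cover => eq_u.
have lt_u : (mdeg u < a.+1)%N by rewrite (eqP eq_u).
apply/mapP; exists (exist (fun u : 'X_{1..N.+1 < a.+1} => mdeg u == a)
  (BMultinom lt_u) eq_u : form_monomial N.+1 a) => //.
by rewrite mem_enum.
Qed.

(** There are more monomials of degree [t] than linear conditions imposed by the points. *)
Lemma exists_form n (p : 'I_n -> point K N) t : (n < 'C(t + N, t))%N ->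
  exists F : {mpoly K[N.+1]}, [/\ F != 0, F \is t.-homog & points_ideal p F].
Proof.
move=> lt_n; pose M := \matrix_(c < #|form_monomial N.+1 t|, j < n)
  ('X_[val (val (enum_val c))] : {mpoly K[N.+1]}).@[Defs.coord (p j)].
have : kermx M != 0.
  rewrite kermx_eq0 /row_free neq_ltn (leq_ltn_trans (rank_leq_col M)) //.
  exact: leq_trans lt_n (leq_card_form_monomial t).
case/rowV0Pn=> v /sub_kermxP vM v_neq0.
pose F := \sum_c v^T c 0 *: 'X_[val (val (enum_val c))] : {mpoly K[N.+1]}.
have homF : F \is t.-homog by exact: form_sum_homog.
exists F; split=> //.
  have [c vc] := rV0Pn _ v_neq0; apply: contraNneq vc => F0.
  by have := mcoeff_form_sum v^T c; rewrite -/F F0 mcoeff0 mxE => <-.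
move=> j; apply: point_ideal_form homF _.
have /rowP/(_ j) := vM; rewrite !mxE /F (raddf_sum (meval _)) => vM0.
rewrite -[RHS]vM0; apply: eq_bigr => c _ /=.
by rewrite mevalZ !mxE.
Qed.

(** [alpha] is chosen by [epsilon], so its property becomes available once some nonzero form is
    known. *)
Lemma alphaP k (J : {mpoly K[k]} -> Prop) : (exists t, has_form J t) ->
  has_form J (alpha J) /\ forall s, has_form J s -> (alpha J <= s)%N.
Proof.
case/ex_minimal=> t Jt le_t.
exact: (epsilon_spec (inhabits 0%N)
  (fun t => has_form J t /\ forall s, has_form J s -> (t <= s)%N)
  (ex_intro _ t (conj Jt le_t))).
Qed.

End Ideals.

(** A form of degree [t] through the points gives [alpha(I) <= t], so the bound with [t] is at least
    as strong as the desired one. *)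
Lemma chudnovsky_of_forms (K : fieldType) n (p : 'I_n -> point K 3) t :
  (n < 'C(t + 3, t))%N ->
  (forall m d (F : {mpoly K[4]}), F != 0 -> F \is d.-homog ->
     (forall j, mult_ge m (Defs.coord (p j)) F) -> (m * (t + 2) <= 3 * d)%N) ->
  forall m : nat, (1 <= m)%N ->
    m%:R * (((alpha (points_ideal p))%:R + 2) / 3)
      <= (alpha (symbolic_power p m))%:R :> rat.
Proof.
move=> lt_n bound m m_gt0; have [F [F_neq0 homF IF]] := exists_form p lt_n.
have formI : has_form (points_ideal p) t by exists F.
have [_ /(_ _ formI) le_alpha] := alphaP (ex_intro _ _ formI).
(* This form ensures that [alpha] of the symbolic power is attained. *)
have formIm : has_form (symbolic_power p m) (t * m).
  exists (F ^+ m); split; [exact: symbolic_powerX| by rewrite expf_neq0|].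
  exact: dhomogMn.
have [[G [IG G_neq0 homG]] _] := alphaP (ex_intro _ _ formIm).
have := bound _ _ _ G_neq0 homG (symbolic_power_mult_ge IG).
set b := alpha _ => le_t.
have {le_t} : (m * (alpha (points_ideal p) + 2) <= 3 * b)%N.
  by apply: leq_trans le_t; rewrite leq_mul2l leq_add2r le_alpha orbT.
by rewrite -(ler_nat rat) !natrM natrD mulrA ler_pdivrMr // [b%:R * _]mulrC.
Qed.

(** * Descent by Frobenius *)

(** The entries are integer polynomials in the coordinates, so raising the coordinates to the power
    [p] applies Frobenius to the minor. *)
Lemma interpolation_minor_frob (p e : nat) (L : fieldType) (charL : p \in [pchar L])
    (N n k D : nat) f (b : 'I_n -> 'I_N -> L) :
  interpolation_minor (k := k) (D := D) f b != 0 ->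
  interpolation_minor (k := k) (D := D) f (fun j i => b j i ^+ (p ^ e)) != 0.
Proof.
move=> minor_neq0; elim: e => [|e IHe]; first by rewrite expn0.
suff -> : interpolation_minor f (fun j i => b j i ^+ (p ^ e.+1)) =
    pFrobenius_aut charL
      (interpolation_minor (k := k) (D := D) f (fun j i => b j i ^+ (p ^ e))).
  by rewrite fmorph_eq0.
rewrite rmorph_interpolation_minor; congr (interpolation_minor f _).
apply: functional_extensionality => j; apply: functional_extensionality => i.
by rewrite /= pFrobenius_autE -exprM expnSr.
Qed.

(* The reduction modulo a prime [p] is applied to a power of [F] chosen so that
   its multiplicity is at least [q * (k + N)] for a large power [q] of [p]. *)
Lemma minor_bound_pchar (p : nat) (L : fieldType) (charL : p \in [pchar L])
    (N n k D c m d : nat) f (b : 'I_n -> 'I_N.+1 -> L) (F : {mpoly L[N.+1]}) :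
  ((k + N.+1) * c <= 3 * D)%N ->
  interpolation_minor (k := k) (D := D) f b != 0 ->
  F != 0 -> F \is d.-homog -> (forall j, mult_ge m (b j) F) ->
  (m * c <= 3 * d)%N.
Proof.
move=> le_D minor_neq0 F_neq0 homF multF; rewrite leqNgt; apply/negP=> lt_d.
have m_gt0 : (0 < m)%N by lia.
have p_gt1 : (1 < p)%N by apply/prime_gt1/(pcharf_prime charL).
(* This makes [q > m^2 c], which absorbs the error from rounding [q / m] up to the integer [w]. *)
pose e := (m * m * c)%N; pose q := (p ^ e)%N.
have lt_q : (e < q)%N by apply: ltn_expl.
pose w := (q %/ m).+1.
have le_w : (q <= w * m)%N by apply/ltnW; rewrite ltn_ceil.
have ge_w : (w * m <= q + m)%N by rewrite mulSn addnC leq_add2r leq_trunc_div.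
have Fw_neq0 : F ^+ ((k + N.+1) * w) != 0 by rewrite expf_neq0.
have homFw := dhomogMn ((k + N.+1) * w) homF.
have multFw j : mult_ge (q * (k + N.+1)) (b j) (F ^+ ((k + N.+1) * w)).
  apply: mult_geW (mult_geX (multF j)).
  by rewrite mulnC -mulnA leq_mul2l le_w orbT.
have [G [t [G_neq0 homG le_t multG]]] := frobenius_descent charL Fw_neq0 homFw multFw.
have le_tD : (t <= D)%N.
  have h1 : (q * t * m <= d * (k + N.+1) * (q + m))%N.
    apply: leq_trans (_ : d * (k + N.+1) * (w * m) <= _)%N; last first.
      by rewrite leq_mul2l ge_w orbT.
    by rewrite !mulnA leq_mul2r; apply/orP; right; rewrite -!mulnA.
  (* The strict inequality [3d + 1 <= mc] gains [q + m], which outweighs the excess [m c m]. *)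
  have h2 : (3 * d * (q + m) <= m * c * q)%N.
    have : ((3 * d).+1 * (q + m) <= m * c * (q + m))%N by rewrite leq_mul2r lt_d orbT.
    have : (m * c * m <= q)%N by rewrite mulnAC ltnW.
    rewrite mulSn !mulnDr; lia.
  have h3 : (3 * (q * t * m) <= (k + N.+1) * c * (q * m))%N.
    apply: leq_trans (_ : (k + N.+1) * (3 * d * (q + m)) <= _)%N.
      rewrite (_ : _ * (3 * d * (q + m)) = 3 * (d * (k + N.+1) * (q + m)))%N.
        by rewrite leq_mul2l.
      ring.
    rewrite (_ : _ * c * (q * m) = (k + N.+1) * (m * c * q))%N ?leq_mul2l ?h2 ?orbT //; ring.
  have qm_gt0 : (0 < q * m)%N by rewrite muln_gt0 m_gt0 (leq_ltn_trans _ lt_q).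
  have : (q * m * (3 * t) <= q * m * (3 * D))%N.
    rewrite (_ : q * m * (3 * t) = 3 * (q * t * m))%N; last by ring.
    by apply: leq_trans h3 _; rewrite mulnC leq_mul2l le_D orbT.
  by rewrite leq_pmul2l // leq_pmul2l.
(* The minor concerns degree exactly [D], so [G] is padded with a power of a variable. *)
have : G * 'X_ord0 ^+ (D - t) = 0.
  apply: (interpolation_minor_neq0 (interpolation_minor_frob e charL minor_neq0)).
    have homX : 'X_ord0 ^+ (D - t) \is [in L[N.+1], (D - t).-homog].
      by rewrite mpolyXn dhomogX /= mdegMn mdeg1 mul1n.
    by have := dhomogM homG homX; rewrite subnKC.
  by move=> j; rewrite mulrC; apply: mult_geMl.
by apply/eqP; rewrite mulf_neq0 // expf_neq0 // -msize_poly_eq0 msizeX.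
Qed.

Lemma mcoeff_lincomb (R : nzRingType) (N : nat) (s : seq 'X_{1..N}) (f : 'X_{1..N} -> R) u :
  uniq s -> (\sum_(b <- s) f b *: 'X_[b])@_u = if u \in s then f u else 0.
Proof.
move=> uniq_s; rewrite raddf_sum /=; case: ifP => [u_s|/negP u_s].
  rewrite (bigD1_seq u) //= mcoeffZ mcoeffX eqxx mulr1 big1 ?addr0 // => b /negPf ne.
  by rewrite mcoeffZ mcoeffX ne mulr0.
rewrite big_seq big1 // => b b_s; rewrite mcoeffZ mcoeffX.
by case: eqP => [eq_bu|_]; [rewrite eq_bu in b_s | rewrite mulr0].
Qed.

(** [F] and the points are lifted to [A] and specialized to characteristic [p]. Vanishing Taylor
    coefficients over [K] still vanish, because [psi] kills the kernel of [phi]. *)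
Lemma minor_bound (K : fieldType) (charK0 : [pchar K] =i pred0)
    (N n k D c m d : nat) f (a : 'I_n -> 'I_N.+1 -> K) (F : {mpoly K[N.+1]}) :
  ((k + N.+1) * c <= 3 * D)%N ->
  interpolation_minor (k := k) (D := D) f a != 0 ->
  F != 0 -> F \is d.-homog -> (forall j, mult_ge m (a j) F) ->
  (m * c <= 3 * d)%N.
Proof.
move=> le_D minor_neq0 F_neq0 /dhomogP homF multF.
pose s := [seq F@_b | b <- msupp F] ++ [seq a ji.1 ji.2 | ji : ('I_n * 'I_N.+1)%type].
have [A [phi [phi_spec phi_onto]]] := specializable_subring charK0 s.
pose pre x := epsilon (inhabits 0) (fun y : A => phi y = x).
have preK x : x \in s -> phi (pre x) = x.
  by move=> /phi_onto; apply: epsilon_spec.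
pose a' j i := pre (a j i).
have phi_a j : phi \o a' j = a j.
  apply: functional_extensionality => i /=; apply: preK; rewrite mem_cat.
  by apply/orP; right; apply/imageP; exists (j, i).
(* The lift has no monomials outside the support of [F], so its specialization stays homogeneous. *)
pose F' : {mpoly A[N.+1]} := \sum_(b <- msupp F) pre F@_b *: 'X_[b].
have F'E u : F'@_u = if u \in msupp F then pre F@_u else 0.
  by rewrite mcoeff_lincomb ?msupp_uniq.
have phi_coef u : u \in msupp F -> phi (pre F@_u) = F@_u.
  by move=> u_supp; apply: preK; rewrite mem_cat; apply/orP; left; apply/mapP; exists u.
have phi_F : map_mpoly phi F' = F.
  apply/mpolyP=> u; rewrite mcoeff_map_mpoly F'E.
  by case: ifP => [/phi_coef //|/negbT/memN_msupp_eq0 ->]; exact: rmorph0.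
pose u := mlead F; have u_supp : u \in msupp F by apply: mlead_supp.
have phi_minor : phi (interpolation_minor f a') != 0.
  rewrite rmorph_interpolation_minor.
  by have -> : (fun j => phi \o a' j) = a by apply: functional_extensionality.
have phi_lead : phi (pre F@_u) != 0 by rewrite (phi_coef _ u_supp) -mcoeff_msupp.
(* One product keeps both the minor and a coefficient of [F] nonzero under the specialization. *)
have : phi (interpolation_minor f a' * pre F@_u) != 0.
  by rewrite rmorphM; exact: mulf_neq0 phi_minor phi_lead.
case/phi_spec=> p [L [psi [charL]]].
rewrite rmorphM mulf_eq0 negb_or => /andP[minor' Fu] ker.
rewrite rmorph_interpolation_minor in minor'.
apply: (minor_bound_pchar charL (F := map_mpoly psi F') le_D minor').
- apply: contraNneq Fu => /(congr1 (mcoeff u)).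
  by rewrite mcoeff_map_mpoly F'E u_supp mcoeff0 => ->.
- apply/dhomogP=> b; rewrite mcoeff_msupp mcoeff_map_mpoly F'E.
  by case: ifP => [/homF //|_] /eqP[]; exact: rmorph0.
- move=> j b ltb; rewrite -map_shift mcoeff_map_mpoly; apply: ker.
  by rewrite -mcoeff_map_mpoly map_shift phi_F phi_a; apply: multF.
Qed.

Lemma general_position_neq0 (K : fieldType) (N n : nat) (G : {mpoly K[n * N.+1]})
    (P : ('I_n -> point K N) -> Prop) :
  multihomog G -> (exists p : 'I_n -> point K N, eval_points p G != 0) ->
  (forall p, eval_points p G != 0 -> P p) -> general_position P.
Proof.
move=> homG exG HP; exists (fun p => eval_points p G != 0); split=> //.
exists (eq G); split=> [_ <- //|p]; split=> [Gp|[_ <- //]].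
by exists G.
Qed.

Lemma bin3 a : (6 * 'C(a + 2, 3) = a * (a + 1) * (a + 2))%N.
Proof.
have := bin_ffact (a + 2) 3; rewrite {2}addn2 !ffactSS ffactn1 mulnC => ->.
rewrite -addn1 -[a.+1]addn1; ring.
Qed.

Lemma initial_degree n : (1 <= n)%N ->
  exists a, [/\ (1 <= a)%N, ('C(a + 2, 3) <= n)%N & (n < 'C(a + 3, a))%N].
Proof.
move=> n_gt0.
have binE a : 'C(a + 3, a) = 'C(a.+1 + 2, 3).
  by rewrite -(bin_sub (leq_addr _ _)) addKn addSnnS.
have : exists a, (n < 'C(a + 3, a))%N.
  by exists n; rewrite binE; have := bin3 n.+1; nia.
case/ex_minimal=> -[|a] lt_n min_a; first by move: lt_n; rewrite binE /= ltnNge n_gt0.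
exists a.+1; split=> //; rewrite -binE leqNgt; apply/negP=> /min_a.
by rewrite ltnn.
Qed.

(** * Linear changes of coordinates *)

Section CoordinatePoints.

Variables (K : fieldType) (N : nat).
Implicit Types (F : {mpoly K[N]}) (M : 'M[K]_N) (u v b : 'X_{1..N}).

Lemma mcoeff_shiftX_gt (a : 'I_N -> K) u b :
  (mdeg u < mdeg b)%N -> (shift a 'X_[u])@_b = 0.
Proof.
pose low t (P : {mpoly K[N]}) := forall b, b \in msupp P -> (mdeg b <= t)%N.
have lowM s t P Q : low s P -> low t Q -> low (s + t)%N (P * Q).
  move=> lP lQ c /msuppM_le /allpairsP[[c1 c2] [/= /lP l1 /lQ l2 ->]].
  by rewrite mdegD leq_add.
have low1 : low 0%N 1 by move=> c; rewrite msupp1 inE => /eqP ->; rewrite mdeg0.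
suff lowX : low (mdeg u) (shift a 'X_[u]).
  by move=> lt_ub; apply: memN_msupp_eq0; apply/negP=> /lowX; rewrite leqNgt lt_ub.
rewrite mpolyXE_id rmorph_prod mdegE; elim/big_rec2: _ => // i x y _ IH.
apply: (lowM) => //; rewrite rmorphXn /= shiftX; elim: (u i) => // k IHk.
rewrite exprS -add1n; apply: (lowM) => // c /msuppD_le.
rewrite mem_cat msuppX inE => /orP[/eqP ->|]; first by rewrite mdeg1.
by rewrite msuppC; case: eqP => // _; rewrite inE => /eqP ->; rewrite mdeg0.
Qed.

(** Translation does not raise the degree, so for [m > d] all Taylor coefficients vanish. *)
Lemma mult_ge_degree m d (a : 'I_N -> K) F :
  F != 0 -> F \is d.-homog -> mult_ge m a F -> (m <= d)%N.
Proof.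
move=> F_neq0 /dhomogP homF multF; rewrite leqNgt; apply: contra_neqN F_neq0 => lt_dm.
rewrite -(shiftK a F) (_ : shift a F = 0) ?rmorph0 //; apply/mpolyP=> b.
rewrite mcoeff0; have [/multF //|le_mb] := ltnP (mdeg b) m.
rewrite shiftE raddf_sum big_seq big1 //= => u /homF du.
by rewrite mcoeffZ mcoeff_shiftX_gt ?mulr0 // du (leq_trans lt_dm).
Qed.

(** This is [F(xM)] for a row vector [x]; thus the [j]-th coordinate point is sent to the row
    [M j]. *)
Definition linear_subst M F : {mpoly K[N]} :=
  F \mPo [tuple \sum_l M l i *: 'X_l | i < N].

HB.instance Definition _ M := GRing.RMorphism.copy (linear_subst M) (linear_subst M).
HB.instance Definition _ M := GRing.Linear.copy (linear_subst M) (linear_subst M).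

Lemma linear_substX M i : linear_subst M 'X_i = \sum_l M l i *: 'X_l.
Proof. by rewrite /linear_subst comp_mpolyXU -tnth_nth tnth_mktuple. Qed.

Lemma linear_substE M F :
  linear_subst M F = \sum_(b <- msupp F) F@_b *: linear_subst M 'X_[b].
Proof. exact: comp_mpolyEX. Qed.

Lemma linear_subst_homog M u : linear_subst M 'X_[u] \is (mdeg u).-homog.
Proof.
have homX i : linear_subst M 'X_i \is 1.-homog.
  rewrite linear_substX; apply: rpred_sum => l _; apply: dhomogZ.
  by rewrite dhomogX /= mdeg1.
rewrite mpolyXE_id rmorph_prod mdegE.
elim/big_rec2: _ => [|i x y _ IH]; first exact: dhomog1.
by rewrite rmorphXn; apply: dhomogM IH; have := dhomogMn (u i) (homX i); rewrite mul1n.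
Qed.

Lemma linear_substK M F : M \in unitmx ->
  linear_subst (invmx M) (linear_subst M F) = F.
Proof.
move=> uM; rewrite (linear_substE M) (linear_sum (linear_subst _)) [RHS]mpolyE.
apply: eq_bigr => b _; rewrite linearZ /= [in LHS]mpolyXE_id [in RHS]mpolyXE_id.
rewrite !rmorph_prod; congr (_ *: _); apply: eq_bigr => i _.
rewrite !rmorphXn /= linear_substX (linear_sum (linear_subst _)); congr (_ ^+ _).
transitivity (\sum_r (invmx M *m M) r i *: 'X_r : {mpoly K[N]}).
  under eq_bigr do rewrite linearZ /= linear_substX scaler_sumr.
  rewrite exchange_big /=; apply: eq_bigr => r _; rewrite mxE scaler_suml.
  by apply: eq_bigr => l _; rewrite scalerA mulrC.
rewrite mulVmx // (bigD1 i) //= mxE eqxx scale1r big1 ?addr0 // => r /negPf ne.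
by rewrite mxE ne scale0r.
Qed.

Lemma shift_linear_subst M j F :
  shift (fun i => (i == j)%:R) (linear_subst M F) = linear_subst M (shift (M j) F).
Proof.
rewrite (linear_substE M F) (shiftE (M j) F).
rewrite (linear_sum (shift _)) (linear_sum (linear_subst M)).
apply: eq_bigr => b _; rewrite linearZ [RHS]linearZ; congr (_ *: _).
rewrite mpolyXE_id !rmorph_prod; apply: eq_bigr => i _.
rewrite !rmorphXn /= linear_substX shiftX rmorphD /= linear_substX; congr (_ ^+ _).
rewrite (linear_sum (shift _)) [X in _ = _ + X]comp_mpolyC.
under eq_bigr do rewrite linearZ /= shiftX scalerDr.
rewrite big_split /=; congr (_ + _).
rewrite (bigD1 j) //= eqxx mpolyC1 big1 => [|l /negPf ne].
  by rewrite addr0 -mul_mpolyC mulr1.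
by rewrite ne mpolyC0 scaler0.
Qed.

(** A linear substitution preserves degrees, so it creates no Taylor terms of order below [m]. *)
Lemma mult_ge_linear_subst M m j F : mult_ge m (M j) F ->
  mult_ge m (fun i => (i == j)%:R) (linear_subst M F).
Proof.
move=> multF b ltb; rewrite shift_linear_subst linear_substE raddf_sum big_seq big1 //=.
move=> u _; rewrite mcoeffZ.
have [ltu|leu] := ltnP (mdeg u) m; first by rewrite multF ?mul0r.
rewrite (dhomog_nemf_coeff (linear_subst_homog M u)) ?mulr0 //=.
by apply: contraTneq ltb => ->; rewrite -leqNgt.
Qed.

(** Setting [x_j = 1] keeps the monomials of [F] distinct, and the one from [u] has degree
    [d - u j], which must be at least [m]. *)
Lemma mult_ge_coordinate_point m d j F u : F \is d.-homog ->
  mult_ge m (fun i => (i == j)%:R) F -> u \in msupp F -> (m + u j <= d)%N.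
Proof.
move=> /dhomogP homF multF u_supp.
pose drop_j v := [multinom if i == j then 0%N else v i | i < N].
have drop_jK v : (drop_j v + U_(j) *+ v j)%MM = v.
  apply/mnmP=> i; rewrite mnmDE mulmnE mnm1E !mnmE eq_sym.
  by case: eqP => [->|_]; rewrite ?mul1n ?addn0.
have mdeg_drop v : (mdeg (drop_j v) + v j = mdeg v)%N.
  by rewrite -[in RHS](drop_jK v) mdegD mdegMn mdeg1 mul1n.
(* Modulo [x_j] the power is [1], which isolates the coefficient at a monomial free of [x_j]. *)
have expand k : exists Q : {mpoly K[N]}, ('X_j + 1) ^+ k = 1 + Q * 'X_j.
  elim: k => [|k [Q IHk]]; first by exists 0; rewrite expr0 mul0r addr0.
  exists (1 + Q * 'X_j + Q); rewrite exprS IHk; ring.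
have coefE v : (shift (fun i => (i == j)%:R) 'X_[v])@_(drop_j u) =
    (drop_j v == drop_j u)%:R :> K.
  have -> : shift (fun i => (i == j)%:R : K) 'X_[v] = 'X_[drop_j v] * ('X_j + 1) ^+ v j.
    rewrite [in LHS]mpolyXE_id [X in _ = X * _]mpolyXE_id rmorph_prod.
    rewrite (bigD1 j) //= [X in _ = X * _](bigD1 j) //= mnmE eqxx expr0 mul1r mulrC.
    rewrite rmorphXn /= shiftX eqxx mpolyC1; congr (_ * _).
    apply: eq_bigr => i /negPf ne.
    by rewrite rmorphXn /= shiftX ne mpolyC0 addr0 mnmE ne.
  have [Q ->] := expand (v j).
  rewrite mulrDr mulr1 mulrA mcoeffD mcoeffX mcoeffMX_eq0 ?addr0 //.
  by rewrite lep1mP mnmE eqxx.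
rewrite leqNgt; apply/negP=> lt_d.
have lt_drop : (mdeg (drop_j u) < m)%N.
  by have := mdeg_drop u; have := homF _ u_supp => /= ->; lia.
have := multF _ lt_drop; rewrite shiftE raddf_sum (bigD1_seq u) //= big_seq_cond big1.
  by rewrite addr0 mcoeffZ coefE eqxx mulr1 => /eqP; rewrite mcoeff_eq0 u_supp.
move=> v /andP[v_supp neq_vu]; rewrite mcoeffZ coefE; case: eqP => [eq_drop|_].
  have := mdeg_drop v; rewrite eq_drop.
  have := mdeg_drop u; rewrite [mdeg u]homF // [mdeg v]homF // => <- /addnI eq_j.
  by case/eqP: neq_vu; rewrite -(drop_jK v) eq_drop eq_j drop_jK.
by rewrite mulr0.
Qed.

(** After moving the points to the coordinate points, sum [m + u j <= d] over [j] for one monomial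
    [u] of degree [d]. *)
Lemma independent_points_bound m d M F : M \in unitmx ->
  F != 0 -> F \is d.-homog -> (forall j, mult_ge m (M j) F) ->
  (N * m + d <= N * d)%N.
Proof.
move=> uM F_neq0 /dhomogP homF multF; pose G := linear_subst M F.
have G_neq0 : G != 0.
  by apply: contraNneq F_neq0 => G0; rewrite -(linear_substK F uM) -/G G0 rmorph0.
have homG : G \is d.-homog.
  rewrite /G linear_substE big_seq; apply: rpred_sum => b /homF <-.
  by apply: dhomogZ; apply: linear_subst_homog.
have u_supp : mlead G \in msupp G by apply: mlead_supp.
have du : mdeg (mlead G) = d by have /dhomogP := homG; apply.
have : (\sum_(j < N) (m + mlead G j) <= \sum_(j < N) d)%N.
  apply: leq_sum => j _; apply: mult_ge_coordinate_point homG _ u_supp.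
  exact: mult_ge_linear_subst.
by rewrite big_split /= -mdegE du !sum_nat_const card_ord.
Qed.

End CoordinatePoints.

(** * Special configurations *)

Section Configurations.

Variable K : fieldType.

Lemma point_of_coords N (v : 'I_N.+1 -> K) : (exists i, v i != 0) ->
  exists p : point K N, Defs.coord p = v.
Proof.
case=> i vi_neq0; have row_neq0 : \row_j v j != 0.
  by apply: contraNneq vi_neq0 => /rowP/(_ i); rewrite !mxE => ->.
exists (exist (fun w : 'rV[K]_N.+1 => w != 0) _ row_neq0).
apply: functional_extensionality => j.
by rewrite /Defs.coord mxE.
Qed.

Lemma points_of_coords N n (v : 'I_n -> 'I_N.+1 -> K) :
  (forall j, exists i, v j i != 0) ->
  exists p : 'I_n -> point K N, forall j, Defs.coord (p j) = v j.
Proof.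
move=> v_neq0; pose P j (p : point K N) := Defs.coord p = v j.
have exP j : exists p, P j p by exact: point_of_coords.
exists (fun j => sval (constructive_indefinite_description _ (exP j))) => j.
exact: (svalP (constructive_indefinite_description _ (exP j))).
Qed.

Lemma points_through (s : seq (nat * (nat * nat))) n : (size s <= n)%N ->
  exists p : 'I_n -> point K 3, forall x y z, (x, (y, z)) \in s ->
    exists j, Defs.coord (p j) = affine_point x%:R y%:R z%:R.
Proof.
move=> le_n; pose t (j : nat) := nth (0, (0, 0))%N s j.
have [j|p pE] := @points_of_coords 3 n
  (fun j => affine_point (t j).1%:R (t j).2.1%:R (t j).2.2%:R).
  by exists ord0; rewrite /affine_point /= oner_eq0.
exists p => x y z xyz_s; have lt_ix : (index (x, (y, z)) s < n)%N.
  by apply: leq_trans le_n; rewrite index_mem.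
by exists (Ordinal lt_ix); rewrite pE /t /= nth_index.
Qed.

Definition grid k : seq (nat * (nat * nat)) :=
  [seq (x, yz) | x <- iota 0 k, yz <- [seq (y, z) | y <- iota 0 k, z <- iota 0 k]].

Lemma mem_grid k x y z :
  ((x, (y, z)) \in grid k) = [&& (x < k)%N, (y < k)%N & (z < k)%N].
Proof.
have pairE (T U : eqType) (s : seq T) (r : seq U) a b :
    ((a, b) \in [seq (a, b) | a <- s, b <- r]) = (a \in s) && (b \in r).
  by apply/allpairsP/andP=> [[[? ?] [/= ? ? [-> ->]]] //|[? ?]]; exists (a, b).
by rewrite /grid !pairE !mem_iota.
Qed.

Lemma size_grid k : size (grid k) = (k * (k * k))%N.
Proof. by rewrite !size_allpairs size_iota. Qed.

Definition triangle := [seq t <- grid 3 | (t.1 < 3 - t.2.1)%N].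

End Configurations.

Lemma grid_size_bound a : (3 <= a)%N -> a <> 4%N ->
  exists k, [/\ (0 < k)%N, (a + 3 <= 3 * k)%N & (k * (k * k) <= 'C(a + 2, 3))%N].
Proof.
move=> a_ge3 a_neq4; exists ((a + 5) %/ 3)%N.
have Db := divn_eq (a + 5) 3; have := ltn_pmod (a + 5) (isT : (0 < 3)%N).
have := bin3 a; move: ((a + 5) %/ 3)%N ((a + 5) %% 3)%N Db => b r Db EC ltr.
split; [lia|lia|].
have {EC} EC : (6 * 'C(a + 2, 3))%N = (a * (a + 1) * (a + 2))%N by [].
rewrite -(leq_pmul2l (isT : (0 < 6)%N)) EC.
have [c Dc] : exists c, b = (c + 2)%N by exists (b - 2)%N; lia.
have : (r = 0 \/ r = 1 \/ r = 2)%N by lia.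
case=> [Dr|[Dr|Dr]]; subst r b.
- have -> : a = (3 * c + 1)%N by lia.
  have [c2|c1] := leqP 2 c; last by lia.
  by nia.
- have -> : a = (3 * c + 2)%N by lia.
  have c1 : (1 <= c)%N by lia.
  by nia.
have -> : a = (3 * c + 3)%N by lia.
by nia.
Qed.

Lemma exists_special_points (K : fieldType) (charK0 : [pchar K] =i pred0) a n :
  (3 <= a)%N -> ('C(a + 2, 3) <= n)%N ->
  exists (k D : nat) (p : 'I_n -> point K 3), ((k + 4) * (a + 2) <= 3 * D)%N /\
    forall F : {mpoly K[4]}, F \is D.-homog ->
      (forall j, mult_ge k (Defs.coord (p j)) F) -> F = 0.
Proof.
move=> a_ge3 le_n; have [a4|a_neq4] := eqVneq a 4%N.
  have [|p pE] := @points_through K triangle n.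
    by apply: leq_trans le_n; rewrite a4.
  exists 49%N, 106%N, p; split=> [|F homF multF]; first by rewrite a4.
  apply/eqP/negPn/negP=> F_neq0; have := triangle_bound charK0 F_neq0 homF.
  move=> /(_ 49%N) H; suff : (13 * 49 <= 6 * 106)%N by [].
  apply: H => x y z ltx lty ltz.
  have [|j <-] := pE x y z; last exact: multF.
  by rewrite mem_filter mem_grid /= ltx lty ltz (leq_trans ltx) // leq_subr.
have [k [k_gt0 le_k le_kn]] := grid_size_bound a_ge3 (elimN eqP a_neq4).
have [|p pE] := @points_through K (grid k) n.
  by rewrite size_grid (leq_trans le_kn).
exists (6 * a + 14)%N, ((2 * a + 6) * (a + 2))%N, p; split=> [|F homF multF].
  by apply/eq_leq; ring.
apply/eqP/negPn/negP=> F_neq0; have H := grid_bound charK0 k_gt0 F_neq0 homF.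
have {H} : (k * (6 * a + 14) <= (2 * a + 6) * (a + 2))%N.
  apply: H => x y z ltx lty ltz; have [|j <-] := pE x y z; last exact: multF.
  by rewrite mem_grid ltx lty.
by nia.
Qed.

Theorem proposition6 (K : fieldType) (charK0 : [pchar K] =i pred0)
    (n : nat) (n_ge1 : (1 <= n)%N) :
  general_position (fun p : 'I_n -> point K 3 =>
    forall m : nat, (1 <= m)%N ->
      m%:R * (((alpha (points_ideal p))%:R + 2) / 3)
        <= (alpha (symbolic_power p m))%:R :> rat).
Proof.
have [a [a_ge1 le_n lt_n]] := initial_degree n_ge1.
have [a1|[a2|a_ge3]] : (a = 1 \/ a = 2 \/ 3 <= a)%N by lia.
- apply: (@general_position_neq0 _ _ _ 1).
  + by apply: of_multidegree_multihomog; rewrite -mpolyC1; exact: of_multidegreeC.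
  + have [j|p _] := @points_of_coords K 3 n (fun _ _ => 1).
      by exists ord0; rewrite oner_eq0.
    by exists p; rewrite /eval_points meval1 oner_eq0.
  move=> p _; apply: chudnovsky_of_forms lt_n _ => m d F F_neq0 homF multF.
  rewrite a1 mulnC leq_mul2l /=.
  exact: mult_ge_degree F_neq0 homF (multF (Ordinal n_ge1)).
- have le4n : (4 <= n)%N by move: le_n; rewrite a2.
  pose M (R : comNzRingType) (b : 'I_n -> 'I_4 -> R) : 'M[R]_4 :=
    \matrix_(i, l) b (widen_ord le4n i) l.
  have evalM (p : 'I_n -> point K 3) :
      eval_points p (\det (M _ (@generic_point K n 3))) =
      \det (M _ (fun j => Defs.coord (p j))).
    rewrite /eval_points -det_map_mx; congr (\det _); apply/matrixP=> i l.
    by rewrite !mxE /= mevalXU mxvecE mxE.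
  apply: (@general_position_neq0 _ _ _ (\det (M _ (@generic_point K n 3)))).
  + apply: (@of_multidegree_multihomog _ _ _
      (fun j => \sum_(i < 4) (j == widen_ord le4n i))%N).
    by apply: of_multidegree_det => i l; rewrite mxE; exact: of_multidegreeX.
  + have [j|p pE] := @points_of_coords K 3 n (fun j i => (i == inord (minn j 3))%:R).
      by exists (inord (minn j 3)); rewrite eqxx oner_eq0.
    exists p; rewrite evalM (_ : M _ _ = 1%:M) ?det1 ?oner_eq0 //.
    apply/matrixP=> i l; rewrite !mxE pE eq_sym; congr (_ == _)%:R.
    apply: val_inj; rewrite /= inordK ?ltnS ?geq_minr //.
    by apply/minn_idPl; rewrite -ltnS.
  move=> p; rewrite evalM => det_neq0.
  apply: chudnovsky_of_forms lt_n _ => m d F F_neq0 homF multF.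
  have uM : M _ (fun j => Defs.coord (p j)) \in unitmx by rewrite unitmxE unitfE.
  have multM i : mult_ge m (M _ (fun j => Defs.coord (p j)) i) F.
    have -> : fun_of_matrix (M _ (fun j => Defs.coord (p j))) i =
        Defs.coord (p (widen_ord le4n i)).
      by apply: functional_extensionality => l; rewrite mxE.
    exact: multF.
  have := independent_points_bound uM F_neq0 homF multM.
  by rewrite a2; lia.
have [k [D [p0 [le_D noF]]]] := exists_special_points charK0 a_ge3 le_n.
have [f f_neq0] := exists_interpolation_minor noF.
apply: (general_position_neq0 (@interpolation_minor_multihomog K 3 n k D f)).
  by exists p0; rewrite eval_interpolation_minor.
move=> p; rewrite eval_interpolation_minor => minor_neq0.
apply: chudnovsky_of_forms lt_n _ => m d F F_neq0 homF multF.
exact: (minor_bound charK0 le_D minor_neq0 F_neq0 homF multF).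
Qed.
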